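(* Let $X$ be the subshift obtained from the marker construction described in the context, and $\mu$ its unique shift-invariant probability measure. For $x\in X$ and $n\in\mathbb{N}$ let $R_n(x) = \inf\{k>0 : x_{[k,k+n)} = x_{[0,n)}\}$ (finite by minimality). Then: (1) For $\mu$-a.e. $x\in X$, the quantity $\limsup_{n\to\infty}\frac{1}{n^{\beta}}\log R_n(x)$, as a function of $\beta>0$, has critical value $1/2$. (2) There is a set $\hat X\subset X$ with $\mu(\hat X)=1$ such that for every $\tau\in[0,1/2]$ there is an increasing sequence $(n_j)_{j\in\mathbb{N}}$ such that for each $x\in\hat X$, the quantity $\lim_{j\to\infty}\frac{1}{(n_j)^{\beta}}\log R_{n_j}(x)$, as a function of $\beta>0$, has critical value $\tau$.
   Context: Marker construction. Let $l_1$ be a sufficiently large perfect square and $N_1 = 2^{\sqrt{l_1}}$. Let $\mathcal{C}_1$ be a set of $N_1$ binary words of length $l_1$, each beginning with $001$, such that the word $00$ occurs in each element of $\mathcal{C}_1$ only as its prefix. Inductively, given a set $\mathcal{C}_j$ of $N_j$ distinct words of length $l_j$ with an ordering $\mathcal{C}_j = \{u_1^{(j)},\dots,u_{N_j}^{(j)}\}$, let $P_j = \{2\}\cup\{i^2 : 2 \le i \le \lfloor\sqrt{N_j}\rfloor\}$, and let $\mathcal{C}_{j+1}$ be the set of all words $u^{(j)}_{\pi(1)}\cdots u^{(j)}_{\pi(N_j)}$ where $\pi$ ranges over permutations of $\{1,\dots,N_j\}$ fixing every element outside $P_j$. Thus $N_{j+1} = (\lfloor\sqrt{N_j}\rfloor)!$,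 $l_{j+1} = l_j N_j$. The ordering of $\mathcal{C}_{j+1}$ is arbitrary except that its first element is $u_1^{(j)}u_2^{(j)}\cdots u_{N_j}^{(j)}$. $X \subset \{0,1\}^{\mathbb{Z}}$ is the set of bi-infinite sequences each finite subword of which is a subword of some word in $\bigcup_j \mathcal{C}_j$; it is strictly ergodic. Critical value: for a family of quantities $F(\beta)\in[0,\infty]$ indexed by $\beta>0$, we say $F$ has critical value $c$ if $F(\beta) = \infty$ for all $0<\beta<c$ and $F(\beta) = 0$ for all $\beta > c$ (for $c=0$: $F(\beta)=0$ for all $\beta>0$). *)

(* Defs.v *)
From HB Require Import structures.
From mathcomp Require Import all_boot all_order all_algebra all_fingroup.
From mathcomp Require Import all_classical all_reals all_analysis.
Set Implicit Arguments. Unset Strict Implicit. Unset Printing Implicit Defensive.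
Import Order.TTheory GRing.Theory Num.Theory.
Local Open Scope ring_scope.
Local Open Scope classical_set_scope.

Definition config := int -> bool.

Definition window (x : config) (a : int) (n : nat) : seq bool :=
  mkseq (fun i => x (a + i%:Z)) n.

Definition sshift (x : config) : config := fun i => x (i + 1).

Definition cylinders : set (set config) :=
  [set A | exists (a : int) (n : nat) (w : seq bool), A = [set x | window x a n = w]].

Definition Omega := g_sigma_algebraType cylinders.

(* Words are [seq bool] (false = 0, true = 1).  An ordered set of words is a
   duplicate-free list; C j below is the ordered set C_{j+1} of the paper
   (so C 0 = C_1). *)

(* 1-indexed marker positions P = {2} U {i^2 : 2 <= i <= floor(sqrt N)} ;
   note i <= floor (sqrt N) <-> i*i <= N. *)
Definition inP (N i : nat) : bool :=
  ((i == 2) || [exists k : 'I_N.+1, (2 <= k) && (k * k == i)])%N.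

(* permutation of {1..N} (here 'I_N, position i <-> index i+1) fixing every
   element outside P *)
Definition admissible (N : nat) (s : {perm 'I_N}) : Prop :=
  forall i : 'I_N, ~~ inP N i.+1 -> s i = i.

Definition perm_word (c : seq (seq bool)) (s : {perm 'I_(size c)}) : seq bool :=
  flatten [seq nth [::] c (s i) | i <- enum 'I_(size c)].

Definition base_words (l1 : nat) (c : seq (seq bool)) : Prop :=
  [/\ uniq c, (exists s, l1 = s * s /\ size c = 2 ^ s)%N &
      forall w, w \in c ->
        [/\ size w = l1, take 3 w = [:: false; false; true] &
            forall i, (i.+1 < size w)%N ->
              nth true w i = false -> nth true w i.+1 = false -> i = 0%N]].

Definition marker_construction (l1 : nat) (C : nat -> seq (seq bool)) : Prop :=
  [/\ base_words l1 (C 0%N),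
      forall j, uniq (C j),
      forall j w, w \in C j.+1 <->
        exists s : {perm 'I_(size (C j))}, admissible s /\ w = perm_word s
    & forall j, head [::] (C j.+1) = flatten (C j)].

Definition subshift (C : nat -> seq (seq bool)) : set config :=
  [set x | forall (a : int) (n : nat), exists j w, w \in C j /\ infix (window x a n) w].

Definition returns_at (x : config) (n k : nat) : bool :=
  (0 < k)%N && (window x k%:Z n == window x 0 n).

(* R_n(x) = min{k > 0 : x_[k,k+n) = x_[0,n)}  (set to 0 if no such k, which
   never happens for x in X by minimality) *)
Definition R_ (x : config) (n : nat) : nat :=
  match pselect (exists k, returns_at x n k) with
  | left h => ex_minn h
  | right _ => 0%N
  end.

Definition critical_value {R : realType} (F : R -> \bar R) (c : R) : Prop :=
  forall b : R, 0 < b -> (b < c -> F b = +oo%E) /\ (c < b -> F b = 0%E).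

(* the same for F b = lim_j u b j, the limit being required to exist (in
   [0, +oo]) whenever b <> c *)
Definition critical_value_lim {R : realType} (u : R -> nat -> R) (c : R) : Prop :=
  forall b : R, 0 < b ->
    (b < c -> (fun j => (u b j)%:E) @ \oo --> +oo%E) /\
    (c < b -> (fun j => (u b j)%:E) @ \oo --> 0%E).

Definition scaled_log_return {R : realType} (x : config) (b : R) (n : nat) : R :=
  ln (R_ x n)%:R / (n%:R `^ b).

(* Main.v *)
(* Write [l] for the word length and [N] for the number of words of level [j].
   A word of level [j] occurs only at aligned positions, and exactly once in
   each word of level [j+1].  Marker positions have density about [N^(-1/2)], so
   by Borel-Cantelli almost every [x] sees, for all large [j], only non-marker
   slots of its level [j+1] word up to time [l * N^(1/4)].  Those slots carry
   the same words in every word of level [j+1], whence [R_n(x)] is exactly the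
   length [l * N] of level [j+1] for [2 l <= n <= l * N^(1/4)].  As
   [ln N = l^(1/2 - o(1))], letting [n] run through powers of [ln (l * N)] inside
   this range realizes every exponent in [0, 1/2].

   For the upper bound on all scales, a window of length [n] with
   [l <= n <= l * N] covers about [n / l] slots, hence [O(sqrt (n / l))] squares,
   so there are at most [exp (O(sqrt n))] windows of length [n], each slot having
   [N <= exp (sqrt l)] possible contents.  The event of a late return has
   measure at most (number of windows) / (time), and Borel-Cantelli gives
   [ln R_n <= O(sqrt n)] almost surely. *)

Require Import Defs.
From HB Require Import structures.
From mathcomp Require Import all_boot all_order all_algebra all_fingroup.
From mathcomp Require Import all_classical all_reals all_analysis.
From mathcomp Require Import zify ring lra.
From Stdlib Require PeanoNat.
Import Order.TTheory GRing.Theory Num.Theory.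
Local Open Scope nat_scope.

(** * Words and marker positions *)

(** Every word of a level therefore starts with the first word of the level below, which is what the
    induction in [word_aligned] rests on. *)
Lemma inP_first N : inP N 1 = false.
Proof.
rewrite /inP /=; apply/existsP => -[k /andP[k2 /eqP kk]].
by move: k2 kk; case: (nat_of_ord k) => [|[|n]] //= _; lia.
Qed.

Lemma nth_flatten_uniform (T : Type) (x0 : T) (l : nat) (ss : seq (seq T)) t r :
  (forall t, t < size ss -> size (nth [::] ss t) = l) ->
  t < size ss -> r < l -> nth x0 (flatten ss) (t * l + r) = nth x0 (nth [::] ss t) r.
Proof.
elim: ss t => [|w ss IH] [|t] //= hs ht hr.
  by rewrite nth_cat /= add0n (hs 0) // hr.
have hw : size w = l := hs 0 isT.
rewrite nth_cat hw mulSn -addnA ltnNge leq_addr /= addKn IH // => t' ht'.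
exact: (hs t'.+1).
Qed.

Lemma size_flatten_uniform (T : Type) (l : nat) (ss : seq (seq T)) :
  (forall t, t < size ss -> size (nth [::] ss t) = l) ->
  size (flatten ss) = size ss * l.
Proof.
elim: ss => [|w ss IH] //= hs.
by rewrite size_cat (hs 0) // mulSn IH // => t ht; apply: (hs t.+1).
Qed.

(* [arrangement c l w f]: the word [w] is the concatenation of the words of [c]
   (all of length [l]) with indices [f 0], [f 1], ..., where [f] is a
   permutation moving only marker positions. *)
Definition arrangement (c : seq (seq bool)) (l : nat) (w : seq bool) (f : nat -> nat) :=
  [/\ size w = size c * l,
      forall t, t < size c -> f t < size c,
      forall t t', t < size c -> t' < size c -> f t = f t' -> t = t',
      forall t, t < size c -> ~~ inP (size c) t.+1 -> f t = t &
      forall t r, t < size c -> r < l ->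
        nth true w (t * l + r) = nth true (nth [::] c (f t)) r].

(** Extended by the identity beyond [N], so that arrangements can be stated on plain naturals. *)
Definition nat_perm N (s : {perm 'I_N}) (t : nat) : nat :=
  if insub t is Some i then s i else t.

Lemma nat_permE N (s : {perm 'I_N}) (i : 'I_N) : nat_perm N s i = s i.
Proof. by rewrite /nat_perm valK. Qed.

Lemma perm_word_arrangement (c : seq (seq bool)) l (s : {perm 'I_(size c)}) :
  (forall w, w \in c -> size w = l) -> admissible s ->
  arrangement c l (perm_word s) (nat_perm _ s).
Proof.
move=> hc hs.
have sz : size [seq nth [::] c (s i) | i <- enum 'I_(size c)] = size c.
  by rewrite size_map size_enum_ord.
have nthE (i : 'I_(size c)) :
    nth [::] [seq nth [::] c (s i) | i <- enum 'I_(size c)] i = nth [::] c (s i).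
  by rewrite (nth_map i) ?size_enum_ord // nth_ord_enum.
have hu t : t < size [seq nth [::] c (s i) | i <- enum 'I_(size c)] ->
    size (nth [::] [seq nth [::] c (s i) | i <- enum 'I_(size c)] t) = l.
  by rewrite sz => ht; rewrite (nthE (Ordinal ht)) hc // mem_nth.
split.
- by rewrite (size_flatten_uniform _ _ _ hu) sz.
- by move=> t ht; rewrite (nat_permE _ s (Ordinal ht)).
- move=> t t' ht ht'; rewrite (nat_permE _ s (Ordinal ht)) (nat_permE _ s (Ordinal ht')).
  by move=> /val_inj /perm_inj [].
- move=> t ht nP; rewrite (nat_permE _ s (Ordinal ht)).
  by have -> := hs (Ordinal ht) nP.
- move=> t r ht hr; rewrite (nat_permE _ s (Ordinal ht)) -nthE.
  by rewrite /perm_word nth_flatten_uniform // sz.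
Qed.

(** * Counting the admissible permutations *)

Definition isqrt (n : nat) : nat := Nat.sqrt n.

Lemma isqrtP n : isqrt n * isqrt n <= n < (isqrt n).+1 * (isqrt n).+1.
Proof. by have := PeanoNat.Nat.sqrt_spec n; rewrite /isqrt; lia. Qed.

Lemma isqrt_sq n : isqrt (n * n) = n.
Proof. by have := isqrtP (n * n); nia. Qed.

Lemma inP_E N i : i <= N -> inP N i -> i = 2 \/ (2 <= isqrt i /\ isqrt i * isqrt i = i).
Proof.
move=> iN /orP[/eqP -> |/existsP [k /andP[k2 /eqP kk]]]; first by left.
by right; rewrite -kk isqrt_sq.
Qed.

Lemma inP_sq N k : 2 <= k -> k * k <= N -> inP N (k * k).
Proof.
move=> k2 kN; apply/orP; right; apply/existsP.
have hk : k < N.+1 by nia.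
by exists (Ordinal hk); rewrite /= k2 eqxx.
Qed.

Section MarkerPositions.
Variable N : nat.
Hypothesis N2 : 4 <= N.

Definition marker_set : {set 'I_N} := [set i : 'I_N | inP N i.+1].

Lemma card_marker_set : #|marker_set| = isqrt N.
Proof.
have [qN Nq] := andP (isqrtP N).
have q2 : 2 <= isqrt N by nia.
(* [v] enumerates the zero-based marker indices: the position 2 takes the place of the missing
   square 1, and the other values are the squares from 4 on. *)
pose v (k : nat) := if k == 0 then 1 else (k.+1 * k.+1).-1.
have vN (k : 'I_(isqrt N)) : v k < N.
  by rewrite /v; have := ltn_ord k; case: eqP => _; nia.
have -> : marker_set = [set Ordinal (vN k) | k : 'I_(isqrt N)].
  apply/setP => i; rewrite inE; apply/idP/imsetP.
  - move=> /(@inP_E _ _ (ltn_ord i)) [i2 | [i2 ii]].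
      have h0 : 0 < isqrt N by lia.
      by exists (Ordinal h0) => //; apply: val_inj => /=; rewrite /v eqxx; lia.
    have hk : (isqrt i.+1).-1 < isqrt N by have := ltn_ord i; nia.
    exists (Ordinal hk) => //; apply: val_inj => /=; rewrite /v.
    by case: eqP => h; [lia | rewrite prednK; lia].
  - move=> [k _ ->] /=; rewrite /v; case: eqP => h //.
    rewrite prednK; last by nia.
    by apply: inP_sq; have := ltn_ord k; nia.
rewrite card_imset ?card_ord // => k k' [] /=; rewrite /v => h.
by apply: val_inj => /=; move: h; do 2 case: eqP => ?; nia.
Qed.

Lemma admissible_perm_on (s : {perm 'I_N}) :
  admissible s <-> s \in perm_on marker_set.
Proof.
split=> [h|/fintype.subsetP h i iP].
- apply/fintype.subsetP => i; rewrite !inE => hi.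
  by apply: contraT => hP; rewrite (h i hP) eqxx in hi.
- by apply/eqP; apply: contraT => /h; rewrite inE (negbTE iP).
Qed.

Lemma card_admissible : #|[set s : {perm 'I_N} | s \in perm_on marker_set]| = (isqrt N)`!.
Proof. by rewrite -card_marker_set -card_perm; apply: eq_card => s; rewrite inE. Qed.

End MarkerPositions.

(** * Invariant measures on configurations *)

Section MeasureOnConfigurations.
Local Open Scope classical_set_scope.
Local Open Scope ereal_scope.

(** There are countably many words, so a set determined by one finite window is a countable union of
    cylinders. *)
Lemma measurable_local (a : int) (n : nat) (Q : set Omega) :
  (forall x y, window x a n = window y a n -> Q x -> Q y) -> measurable Q.
Proof.
move=> hQ.
pose F (w : seq bool) : set Omega :=
  if `[< exists y, Q y /\ window y a n = w >] then [set x | window x a n = w] else set0.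
have -> : Q = \bigcup_w F w.
  apply/seteqP; split=> x.
    by move=> Qx; exists (window x a n) => //; rewrite /F asboolT //; exists x.
  move=> [w _]; rewrite /F; case: asboolP => // -[y [Qy <-]] /= /esym.
  by move=> /hQ; apply.
apply: countable_bigcupT_measurable => // w; rewrite /F; case: asboolP => // _.
by apply: sub_sigma_algebra; exists a, n, w.
Qed.

Lemma measurable_subshift C : measurable (subshift C : set Omega).
Proof.
pose F (p : int * nat) : set Omega :=
  [set x | ~ exists j w, w \in C j /\ infix (window x p.1 p.2) w].
have -> : (subshift C : set Omega) = ~` (\bigcup_p F p).
  apply/seteqP; split=> x.
    by move=> xX [[a n] _] /=; apply; apply: xX.
  by move=> h a n; apply: contrapT => h'; apply: h; exists (a, n).
apply: measurableC; apply: countable_bigcupT_measurable => // -[a n].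
by apply: (measurable_local a n) => x y; rewrite /F /= => ->.
Qed.

Lemma window_iter_shift x i a n :
  window (iter i sshift x) a n = window x (a + i%:Z)%R n.
Proof.
elim: i a => [|i IH] a; first by rewrite addr0.
rewrite iterS.
have -> : window (sshift (iter i sshift x)) a n = window (iter i sshift x) (a + 1)%R n.
  by apply: eq_mkseq => k; rewrite /sshift addrAC.
by rewrite IH -addrA -intS.
Qed.

Lemma measurable_sshift : measurable_fun setT (sshift : Omega -> Omega).
Proof.
apply: (@measurability _ _ Omega Omega setT sshift cylinders) => //.
move=> _ [_ [a [n [w ->]]] <-]; rewrite setTI.
apply: (measurable_local (a + 1)%R n) => x y /=.
by rewrite -[sshift x]/(iter 1 sshift x) -[sshift y]/(iter 1 sshift y) !window_iter_shift => ->.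
Qed.

Context {R : realType} (mu : probability Omega R).

Lemma measure_seq_union (T : eqType) (s : seq T) (D : set Omega) (F : T -> set Omega) (e : \bar R) :
  measurable D -> (forall t, t \in s -> measurable (F t)) ->
  (forall x, D x -> exists2 t, t \in s & F t x) ->
  (forall t, t \in s -> mu (F t) <= e) -> mu D <= (size s)%:R%:E * e.
Proof.
elim: s D => [|t s IH] D mD mF hD he.
  rewrite (_ : D = set0) ?measure0 ?mul0e //.
  by apply/seteqP; split=> // x /hD [].
have e0 : 0 <= e by apply: le_trans (he t (mem_head _ _)); apply: measure_ge0.
have mFt := mF t (mem_head _ _).
have hle : mu (D `\` F t) <= (size s)%:R%:E * e.
  apply: IH => //.
  - exact: measurableD.
  - by move=> u us; apply: mF; rewrite inE us orbT.
  - by move=> x [/hD [u]]; rewrite inE => /orP[/eqP ->//|us Fu _]; exists u.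
  - by move=> u us; apply: he; rewrite inE us orbT.
apply: (@le_trans _ _ (mu (F t `|` D `\` F t))).
  apply: le_measure; rewrite ?inE //.
    by apply: measurableU => //; apply: measurableD.
  by move=> x Dx; case: (pselect (F t x)) => h; [left|right].
apply: le_trans (measureU2 _ _ _) _ => //; first exact: measurableD.
rewrite /= -add1n natrD EFinD ge0_muleDl ?lee_fin // mul1e.
by apply: leeD => //; apply: he; rewrite mem_head.
Qed.

(** The first Borel-Cantelli lemma; summability is given by a bound on partial sums because these
    are later computed in closed form. *)
Lemma measure_lim_sup0 (F : nat -> set Omega) (a : nat -> R) (B : R) :
  (forall k, measurable (F k)) -> (forall k, mu (F k) <= (a k)%:E) ->
  (forall n, \sum_(0 <= i < n) a i <= B)%R -> mu (lim_sup_set F) = 0.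
Proof.
move=> mF hF hB; apply: lim_sup_set_cvg0 => //.
apply: (@le_lt_trans _ _ B%:E); last exact: ltry.
apply: lime_le; first exact: is_cvg_nneseries.
apply: nearW => n; apply: (@le_trans _ _ (\sum_(0 <= i < n) (a i)%:E)).
  by apply: lee_sum => i _; exact: hF.
rewrite (sumEFin (index_iota 0 n) xpredT a).
by rewrite lee_fin.
Qed.

Lemma measure_inter_full (D X : set Omega) : measurable D -> measurable X ->
  mu X = 1 -> mu (D `&` X) = mu D.
Proof.
move=> mD mX X1; apply/eqP; rewrite eq_le; apply/andP; split.
  by apply: le_measure; rewrite ?inE //; exact: measurableI.
have c0 : mu (~` X) = 0 by rewrite probability_setC // X1 subee.
apply: (@le_trans _ _ (mu ((D `&` X) `|` ~` X))).
  apply: le_measure; rewrite ?inE //.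
    by apply: measurableU; [exact: measurableI | exact: measurableC].
  by move=> x Dx; case: (pselect (X x)) => h; [left|right].
apply: (@le_trans _ _ (mu (D `&` X) + mu (~` X))); last by rewrite c0 adde0.
by apply: measureU2; [exact: measurableI | exact: measurableC].
Qed.

Hypothesis mu_inv : forall A : set Omega, measurable A ->
  mu ((sshift : Omega -> Omega) @^-1` A) = mu A.

Lemma measure_iter_shift i (A : set Omega) : measurable A ->
  measurable ((iter i sshift : Omega -> Omega) @^-1` A) /\
  mu ((iter i sshift : Omega -> Omega) @^-1` A) = mu A.
Proof.
elim: i A => [|i IH] A mA //.
have mA' : measurable ((sshift : Omega -> Omega) @^-1` A).
  by rewrite -[X in measurable X]setTI; apply: measurable_sshift.
have [m1 e1] := IH _ mA'; split.
  by rewrite (_ : _ @^-1` A = (iter i sshift : Omega -> Omega) @^-1` (sshift @^-1` A)).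
by rewrite -(mu_inv _ mA) -e1.
Qed.

(* The cheap half of Kac's lemma: the preimages of [D] under the first [K]
   iterates of the shift are pairwise disjoint. *)
Lemma measure_no_return (X D : set Omega) (K : nat) : (0 < K)%N ->
  measurable X -> measurable D -> mu X = 1 ->
  (forall x : Omega, X x -> X (sshift x)) ->
  (forall (x : Omega) i, X x -> D x -> (0 < i < K)%N -> ~ D (iter i sshift x)) ->
  mu D <= (K%:R^-1)%:E.
Proof.
move=> K0 mX mD X1 Xs hD.
have Xi i x : X x -> X (iter i sshift x) by elim: i => //= i IH /IH /Xs.
have mDX : measurable (D `&` X) by exact: measurableI.
pose F i : set Omega := (iter i sshift : Omega -> Omega) @^-1` (D `&` X).
have mF i : measurable (F i) by have [] := measure_iter_shift i _ mDX.
have tF : trivIset `I_K F.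
  have aux i i' x : (i < i' < K)%N -> F i x -> F i' x -> False.
    move=> /andP[ii iK] [D1 X1'] [D2 _].
    apply: (hD _ (i' - i)%N X1' D1); first by lia.
    by rewrite -iterD subnK // ltnW.
  move=> i i' iK i'K [x [Fi Fi']].
  apply/eqP; case: (ltngtP i i') => // h; exfalso.
    by apply: (aux i i' x) => //; rewrite h.
  by apply: (aux i' i x) => //; rewrite h.
suff : K%:R%:E * mu D <= 1.
  rewrite -(fineK (fin_num_measure mu D mD)) -EFinM !lee_fin => h.
  by rewrite -[leRHS]mul1r ler_pdivlMr ?ltr0n // mulrC.
have -> : K%:R%:E * mu D = \sum_(i < K) mu (F i).
  under eq_bigr => i _ do rewrite (measure_iter_shift i _ mDX).2 measure_inter_full //.
  rewrite -(fineK (fin_num_measure mu D mD)) sumEFin sumr_const card_ord.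
  by rewrite -EFinM mulr_natl.
have mU : measurable (\big[setU/set0]_(i < K) F i) by apply: bigsetU_measurable.
have <- : mu (\big[setU/set0]_(i < K) F i) = \sum_(i < K) mu (F i).
  by apply: measure_semi_additive_ord_I.
exact: probability_le1.
Qed.

Lemma window_sub x y a n b m : window x a n = window y a n -> (b + m <= n)%N ->
  window x (a + b%:Z)%R m = window y (a + b%:Z)%R m.
Proof.
move=> e h; apply/eq_in_map => i; rewrite mem_iota add0n => /andP[_ im].
have := congr1 (fun w => nth true w (b + i)) e.
by rewrite !nth_mkseq ?PoszD ?addrA //; lia.
Qed.

End MeasureOnConfigurations.

(** * Logarithms and powers along sequences *)

Section RealEstimates.
Import numFieldNormedType.Exports.
Local Open Scope ring_scope.
Local Open Scope classical_set_scope.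
Context {R : realType}.
Implicit Types (u : nat -> R) (a b c y : R).

(** This is [ln z < z] at [z = y^a]. *)
Lemma ln_le_powR a y : 0 < a -> 0 < y -> ln y <= a^-1 * y `^ a.
Proof.
move=> a0 y0; rewrite -(@ler_pM2l _ a) // mulrA divff ?gt_eqF // mul1r -ln_powR.
by apply: ltW; apply: ln_sublinear; apply: powR_gt0.
Qed.

Lemma ln_le_sqrt y : 0 < y -> ln y <= 2 * Num.sqrt y.
Proof.
move=> y0; have h2 : 0 < 2^-1 :> R by rewrite invr_gt0.
by have := ln_le_powR _ _ h2 y0; rewrite powR12_sqrt ?(ltW y0) // invrK.
Qed.

Lemma ln2_ge : 2^-1 <= ln 2 :> R.
Proof.
have h : expR (2^-1) <= 2 :> R.
  have := expR_ge1Dx (- 2^-1 : R); rewrite expRN => h.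
  have e0 := expR_gt0 (2^-1 : R).
  rewrite -[leRHS]invrK -lef_pV2 ?posrE ?invr_gt0 //; move: h; lra.
by rewrite -[leLHS]expRK ler_ln // posrE ?expR_gt0.
Qed.

Lemma cvgy_powR u a : 0 < a -> u @ \oo --> +oo -> (fun j => u j `^ a) @ \oo --> +oo.
Proof.
move=> a0 /cvgryPge hu; apply/cvgryPge => A.
have := hu (Num.max A 1 `^ a^-1); apply: filterS => j hj.
have m0 : 0 <= Num.max A 1 by rewrite le_max ler01 orbT.
apply: (@le_trans _ _ (Num.max A 1)); first by rewrite le_max lexx.
move: (Num.max A 1) m0 hj => m m0 hj.
have {1}-> : m = (m `^ a^-1) `^ a by rewrite -powRrM mulVf ?gt_eqF // powRr1.
apply: (ge0_ler_powR (ltW a0)) (hj); rewrite nnegrE ?powR_ge0 //.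
by apply: le_trans hj; apply: powR_ge0.
Qed.

Lemma cvgy_mulr u c : 0 < c -> u @ \oo --> +oo -> (fun j => u j * c) @ \oo --> +oo.
Proof.
move=> c0 /cvgryPge hu; apply/cvgryPge => A.
by apply: filterS (hu (A / c)) => j; rewrite ler_pdivrMr.
Qed.

Lemma cvg0_inv u : u @ \oo --> +oo -> (fun j => (u j)^-1) @ \oo --> (0 : R).
Proof.
move=> hu; apply/gtr0_cvgV0 => //.
by move/cvgryPgt : hu => /(_ 0).
Qed.

Lemma cvg0_const_inv u (c : R) : u @ \oo --> +oo -> (fun j => c / u j) @ \oo --> (0 : R).
Proof.
move=> /cvg0_inv hu; rewrite -[X in _ --> X](mulr0 c).
by apply: cvgM => //; apply: cvg_cst.
Qed.

Lemma cvg0_le u v : (\forall j \near \oo, 0 <= u j <= v j) ->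
  v @ \oo --> (0 : R) -> u @ \oo --> (0 : R).
Proof. by move=> h hv; apply: (squeeze_cvgr h) hv; apply: cvg_cst. Qed.

(** Half of the exponent absorbs the logarithm, since [ln u <= (2/a) u^(a/2)]; the other half tends
    to infinity. *)
Lemma cvg0_ln_powR u a : 0 < a -> u @ \oo --> +oo ->
  (fun j => ln (u j) / u j `^ a) @ \oo --> (0 : R).
Proof.
move=> a0 hu; have a2 : 0 < a / 2 by rewrite divr_gt0.
apply: (cvg0_le _ _ _ (cvg0_const_inv _ (a / 2)^-1 (cvgy_powR _ _ a2 hu))).
move/cvgryPge : hu => /(_ 1); apply: filterS => j h1.
have u0 : 0 < u j by apply: lt_le_trans h1.
rewrite divr_ge0 ?ln_ge0 ?powR_ge0 //= ler_pdivrMr ?powR_gt0 //.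
have -> : u j `^ a = u j `^ (a / 2) * u j `^ (a / 2).
  by rewrite -powRD ?(gt_eqF u0) ?implybT // -splitr.
by rewrite mulrA divfK ?gt_eqF ?powR_gt0 // ln_le_powR.
Qed.

End RealEstimates.

(** * Growth of the marker construction *)

Lemma leq_expl e m n : m <= n -> m ^ e <= n ^ e.
Proof. by case: e => [|e] // h; rewrite leq_exp2r. Qed.

Lemma fact_lower n k : n ^ k <= (n + k)`!.
Proof.
elim: k => [|k IH]; first by rewrite expn0 fact_gt0.
by rewrite expnS addnS factS leq_mul //; lia.
Qed.

(** With [n = q - 2k], [fact_lower] gives [n^(2k) <= q!], and [n >= q/2 + 1] gives
    [n^2 >= q + 1]. *)
Lemma fact_pow_lower k q : 4 * k + 2 <= q -> q.+1 ^ k <= q`!.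
Proof.
move=> h; have [n qE] : exists n, q = n + 2 * k by exists (q - 2 * k); lia.
rewrite qE; apply: leq_trans (fact_lower _ _); rewrite expnM.
by apply: leq_expl; rewrite -mulnn; nia.
Qed.

Lemma fact_pow2_lower q : 2 ^ q.-1 <= q`!.
Proof.
case: q => [|q] //=; elim: q => [|q IH] //.
by rewrite factS expnS leq_mul.
Qed.

Lemma fact_upper q : q`! <= q ^ q.
Proof.
elim: q => [|q IH] //; rewrite factS expnS leq_mul //.
by apply: leq_trans IH _; exact: leq_expl.
Qed.

Fixpoint len (l1 : nat) (C : nat -> seq (seq bool)) (j : nat) : nat :=
  if j is j'.+1 then len l1 C j' * size (C j') else l1.

Section Construction.
Context (l1 s : nat) (C : nat -> seq (seq bool)).
Hypotheses (l1E : l1 = s * s) (s_large : 20 <= s) (hC : marker_construction l1 C).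

Notation l := (len l1 C).
Notation N j := (size (C j)).

Lemma C_uniq j : uniq (C j).
Proof. by have [_ ->] := hC. Qed.

Lemma size_C0 : N 0 = 2 ^ s.
Proof.
have [[_ [s' [h ->]] _] _ _ _] := hC; congr (_ ^ _).
by move: h; rewrite l1E; nia.
Qed.

Lemma size_C_word j w : w \in C j -> size w = l j.
Proof.
elim: j w => [|j IH] w.
  by have [[_ _ hw] _ _ _] := hC => /hw [].
have [_ _ hS _] := hC => /hS [p [hp ->]].
by have [-> _ _ _ _] := perm_word_arrangement _ _ _ IH hp; rewrite /= mulnC.
Qed.

Lemma C_arrangement j w : w \in C j.+1 -> exists f, arrangement (C j) (l j) w f.
Proof.
have [_ _ hS _] := hC => /hS [p [hp ->]]; exists (nat_perm _ p).
by apply: perm_word_arrangement => // w'; apply: size_C_word.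
Qed.

Lemma C_word_ext j u v : u \in C j -> v \in C j ->
  (forall i, i < l j -> nth true u i = nth true v i) -> u = v.
Proof.
move=> /size_C_word su /size_C_word sv h.
by apply: (@eq_from_nth _ true) => [|i]; rewrite ?su ?sv //; apply: h.
Qed.

Lemma C_nth_inj j t t' : t < N j -> t' < N j ->
  nth [::] (C j) t = nth [::] (C j) t' -> t = t'.
Proof. by move=> ht ht' /eqP; rewrite nth_uniq ?C_uniq // => /eqP. Qed.

(** The words of level [j] are distinct and of equal length, so a word of level [j+1] determines its
    permutation. The side conditions keep this form available inside the induction [growth], which
    later discharges them in [size_C_succ]. *)
Lemma size_C_succ_aux j : 4 <= N j -> 0 < l j -> (N j.+1 = (isqrt (N j))`!).
Proof.
move=> N4 l0.
have hw w : w \in C j -> size w = l j by apply: size_C_word.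
pose S := [set p : {perm 'I_(N j)} | p \in perm_on (marker_set (N j))].
have eqC : perm_eq (C j.+1) [seq perm_word p | p <- enum S].
  apply: uniq_perm; first exact: C_uniq.
    rewrite map_inj_in_uniq ?enum_uniq // => p p'; rewrite !mem_enum !inE.
    move=> /admissible_perm_on hp /admissible_perm_on hp' e.
    apply/permP => i; apply: val_inj => /=.
    have [_ p1 _ _ p2] := perm_word_arrangement _ _ _ hw hp.
    have [_ p1' _ _ p2'] := perm_word_arrangement _ _ _ hw hp'.
    rewrite -!nat_permE.
    apply: C_nth_inj; [exact: p1|exact: p1'|].
    apply: (C_word_ext j); [by apply: mem_nth; exact: p1|by apply: mem_nth; exact: p1'|].
    by move=> r hr; rewrite -p2 // -p2' // e.
  move=> w; have [_ _ hS _] := hC; apply/idP/mapP.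
    by move=> /hS [p [/admissible_perm_on hp ->]]; exists p => //; rewrite mem_enum inE.
  by move=> [p]; rewrite mem_enum inE => /admissible_perm_on hp ->; apply/hS; exists p.
by rewrite (perm_size eqC) size_map -cardE card_admissible.
Qed.

Lemma pow2_sq n : 4 <= n -> n * n <= 2 ^ n.
Proof.
elim: n => // n IH; rewrite leq_eqVlt => /orP[/eqP <- //|]; rewrite ltnS => h.
by rewrite expnS; have := IH h; nia.
Qed.

(** The bounds are proved together: with [q] the integer root of [N j], [q! >= (q+1)^4 >= (N j)^2],
    which dominates both [l j * N j] and [2^4 * N j]. *)
Lemma growth j : 0 < l j /\ l j <= N j /\ 2 ^ (4 * j + 20) <= N j.
Proof.
elim: j => [|j [l0 [lN NN]]].
  rewrite /= size_C0 l1E leq_exp2l //; split; first by nia.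
  by split; [apply: pow2_sq; lia | lia].
have N20 : 2 ^ 20 <= N j by apply: leq_trans NN; rewrite leq_exp2l //; lia.
have N4 : 4 <= N j by apply: leq_trans N20; rewrite -[4]/(2 ^ 2) leq_exp2l.
have [qN Nq] := andP (isqrtP (N j)).
(* 18 = 4 * 4 + 2 is the threshold of [fact_pow_lower] for the exponent 4. *)
have q18 : 18 <= isqrt (N j).
  have : 19 * 19 <= N j by apply: leq_trans N20; apply: (@leq_trans (2 ^ 9)) => //; rewrite leq_exp2l.
  by move: Nq; nia.
have hf := fact_pow_lower 4 _ q18.
have h2 : N j * N j <= (isqrt (N j))`!.
  by apply: leq_trans hf; rewrite (expnM _ 2 2) -!mulnn leq_mul // ltnW.
rewrite (size_C_succ_aux _ N4 l0) /=; split; first by nia.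
split; first by apply: leq_trans h2; rewrite leq_mul.
apply: leq_trans h2.
have -> : 4 * j.+1 + 20 = (4 * j + 20) + 4 by lia.
rewrite expnD; apply: leq_mul; first exact: NN.
by apply: leq_trans N20; rewrite leq_exp2l.
Qed.

Lemma len_gt0 j : 0 < l j. Proof. by have [] := growth j. Qed.
Lemma len_le_size j : l j <= N j. Proof. by have [_ []] := growth j. Qed.
Lemma size_C_exp j : 2 ^ (4 * j + 20) <= N j. Proof. by have [_ []] := growth j. Qed.
Lemma size_C_large j : 2 ^ 20 <= N j.
Proof. by apply: leq_trans (size_C_exp j); rewrite leq_exp2l //; lia. Qed.
Lemma size_C_gt0 j : 0 < N j.
Proof. by apply: leq_trans (size_C_large j); rewrite expn_gt0. Qed.
Lemma size_C_succ j : N j.+1 = (isqrt (N j))`!.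
Proof.
by apply: size_C_succ_aux (len_gt0 j); apply: leq_trans (size_C_large j); rewrite -[4]/(2 ^ 2) leq_exp2l.
Qed.

Lemma lenS j : l j.+1 = l j * N j. Proof. by []. Qed.

Lemma len_ge3 j : 3 <= l j.
Proof.
elim: j => [|j IH]; first by rewrite /= l1E; nia.
by rewrite lenS; have := size_C_gt0 j; nia.
Qed.

Lemma len_mono : {homo l : i j / i < j}.
Proof.
apply: homo_ltn; first exact: ltn_trans.
move=> j; rewrite lenS; have := len_gt0 j.
have : 2 <= N j by apply: leq_trans (size_C_large j); rewrite -[2]/(2 ^ 1) leq_exp2l.
by nia.
Qed.

Lemma len_le : {homo l : i j / i <= j}.
Proof. by move=> i j; rewrite leq_eqVlt => /orP[/eqP ->//|/len_mono /ltnW]. Qed.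

Lemma len_gt_index j : j < l j.
Proof. by elim: j => [|j IH]; [apply: len_gt0|apply: leq_ltn_trans IH (len_mono _ _ (ltnSn j))]. Qed.

(** With [q] the integer root of [N j], the length of level [j+1] is at most [(N j)^2 <= (q+1)^4],
    whereas its number of words is [q!], which outgrows every fixed power of [q+1]. *)
Lemma len_pow_le_size k : exists J, forall j, J <= j -> l j ^ k <= N j.
Proof.
exists (2 * k + 2) => -[|j] hj; first by lia.
have [qN Nq] := andP (isqrtP (N j)).
rewrite size_C_succ lenS.
apply: (@leq_trans ((isqrt (N j)).+1 ^ (4 * k))).
  rewrite expnM; apply: leq_expl; rewrite (expnM _ 2 2) -!mulnn.
  by have := len_le_size j; nia.
apply: fact_pow_lower.
have h1 : (2 ^ (2 * j + 10)) * 2 ^ (2 * j + 10) <= N j.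
  by rewrite -expnD; apply: leq_trans (size_C_exp j); rewrite leq_exp2l //; lia.
have h2 : 2 ^ (2 * j + 10) <= isqrt (N j) by nia.
apply: leq_trans h2.
have h3 : 2 * j + 10 < 2 ^ (2 * j + 10) by apply: ltn_expl.
have : 2 ^ (2 * j + 10) = 2 ^ (2 * j) * 1024 by rewrite expnD.
have : 2 * j < 2 ^ (2 * j) by apply: ltn_expl.
by lia.
Qed.


(** * Unique parsing *)

(* [conc L g] is the one-sided concatenation [g 0 ++ g 1 ++ ...] of words of
   length [L], as a function on positions. *)
Definition conc (L : nat) (g : nat -> seq bool) (i : nat) : bool :=
  nth true (g (i %/ L)) (i %% L).

Lemma concE L g t r : r < L -> conc L g (t * L + r) = nth true (g t) r.
Proof.
by move=> h; rewrite /conc divnMDl ?(leq_ltn_trans _ h) // divn_small // addn0 modnMDl modn_small.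
Qed.

Lemma modn_mul_split i a b : 0 < a -> 0 < b -> i %% (a * b) = (i %/ a %% b) * a + i %% a.
Proof.
move=> a0 b0; rewrite {1}(divn_eq i a) {1}(divn_eq (i %/ a) b) mulnDl -mulnA (mulnC b) -addnA.
rewrite modnMDl modn_small //.
have := ltn_pmod (i %/ a) b0; have := ltn_pmod i a0; nia.
Qed.

(** Slot [t] of the finer concatenation is slot [t mod N] of the word with number [t / N]. *)
Lemma conc_refine j T g : (forall t, t < T -> g t \in C j.+1) ->
  exists g', (forall t, t < T * N j -> g' t \in C j) /\
    forall i, i < T * l j.+1 -> conc (l j.+1) g i = conc (l j) g' i.
Proof.
move=> hg; pose g' t := take (l j) (drop ((t %% N j) * l j) (g (t %/ N j))).
have N0 := size_C_gt0 j; have l0 := len_gt0 j.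
have key t : t < T * N j -> exists2 u, u \in C j & g' t = u /\
    (forall r, r < l j -> nth true (g (t %/ N j)) ((t %% N j) * l j + r) = nth true u r).
  move=> ht; have htT : t %/ N j < T by rewrite ltn_divLR.
  have hm : t %% N j < N j by rewrite ltn_mod.
  have [f [sz f1 _ _ f2]] := C_arrangement _ _ (hg _ htT).
  have uC : nth [::] (C j) (f (t %% N j)) \in C j by apply: mem_nth; apply: f1.
  exists (nth [::] (C j) (f (t %% N j))) => //; split; last by move=> r; apply: f2.
  have szu := size_C_word _ _ uC.
  have szg : size (g' t) = l j by rewrite /g' size_takel // size_drop sz -mulnBl leq_pmull // subn_gt0.
  apply: (@eq_from_nth _ true) => [|i]; rewrite szg ?szu // => hi.
  by rewrite -(f2 _ _ hm hi) /g' nth_take // nth_drop.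
exists g'; split; first by move=> t /key [u uC [-> _]].
move=> i hi; have lj : l j.+1 = N j * l j by rewrite /= mulnC.
have hq : i %/ l j < T * N j by rewrite ltn_divLR // -mulnA -lj.
have [u uC [gu hu]] := key _ hq.
rewrite /conc gu -(hu (i %% l j)) ?ltn_mod //.
by rewrite /= divnMA modn_mul_split.
Qed.

(** Induction on the level. At level 0 the prefix 00 can only be met at the start of a word. At
    level [j+1], [u] starts with the first word of level [j]; by induction that occurrence fills a
    slot, and in each word of level [j+1] only slot 0 holds this word. *)
Lemma word_aligned j T g u p : (forall t, t < T -> g t \in C j) -> u \in C j ->
  p + l j <= T * l j -> (forall i, i < l j -> conc (l j) g (p + i) = nth true u i) ->
  l j %| p.
Proof.
elim: j T g u p => [|j IH] T g u p hg hu hp hi.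
- have [[_ _ hw] _ _ _] := hC.
  have three w : w \in C 0 -> [/\ nth true w 0 = false, nth true w 1 = false & nth true w 2 = true].
    by move=> /hw [_ + _]; case: w => [|a [|b [|c w]]] //= [-> -> ->].
  have l3 := len_ge3 0; have l0 := len_gt0 0.
  have hq : p %/ l 0 < T by rewrite ltn_divLR //; lia.
  have hr : p %% l 0 < l 0 by rewrite ltn_mod.
  have [u0 u1 u2] := three _ hu.
  have [sg _ hz] := hw _ (hg _ hq).
  have h0 := hi 0 l0; have h1 := hi 1 (ltnW l3); have h2 := hi 2 l3.
  rewrite u0 u1 u2 (divn_eq p (l 0)) in h0 h1 h2.
  case: (ltnP (p %% l 0).+1 (l 0)) => hb.
    rewrite -!addnA addn0 addn1 !concE // in h0 h1.
    by have := hz (p %% l 0); rewrite sg => /(_ hb h0 h1) /eqP.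
  (* Otherwise [p] is the last letter of a word, and the third letter of [u], a 1, falls on the
     second letter of the next word, a 0. *)
  have hq1 : (p %/ l 0).+1 < T.
    by move: hp; rewrite {1}(divn_eq p (l 0)); nia.
  have e2 : p %/ l 0 * l 0 + p %% l 0 + 2 = (p %/ l 0).+1 * l 0 + 1 by nia.
  by have [_ e1 _] := three _ (hg _ hq1); rewrite e2 concE ?e1 // in h2; lia.
- have [g' [hg' gE]] := conc_refine _ _ _ hg.
  have N0 := size_C_gt0 j; have l0 := len_gt0 j.
  have lj : l j.+1 = l j * N j by [].
  have [f [su f1 finj f2 f3]] := C_arrangement _ _ hu.
  have f0 : f 0 = 0 by apply: f2; rewrite ?inP_first.
  have uC : nth [::] (C j) 0 \in C j by apply: mem_nth.
  have hi0 i : i < l j -> conc (l j) g' (p + i) = nth true (nth [::] (C j) 0) i.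
    move=> il; rewrite -gE; last by nia.
    by rewrite hi; [rewrite -[i]add0n -[0](mul0n (l j)) f3 ?f0 | nia].
  have hd : l j %| p.
    by apply: (IH (T * N j) g' _ _ hg' uC) hi0; rewrite -mulnA (mulnC (N j)) -lj; nia.
  have [b pE] := dvdnP hd.
  have hbT : b < T * N j by move: hp; rewrite pE lj; nia.
  have hbd : b %/ N j < T by rewrite ltn_divLR.
  have hbm : b %% N j < N j by rewrite ltn_mod.
  have [h [sh h1 hinj h2 h3]] := C_arrangement _ _ (hg _ hbd).
  have e0 : nth [::] (C j) (h (b %% N j)) = nth [::] (C j) 0.
    apply: (C_word_ext j) => //; first by apply: mem_nth; apply: h1.
    move=> r hr; rewrite -hi0 // -h3 // -gE; last by nia.
    have -> : p + r = (b %/ N j) * l j.+1 + ((b %% N j) * l j + r).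
      by rewrite pE {1}(divn_eq b (N j)) lj; nia.
    by rewrite concE // lj; nia.
  have h00 : h 0 = 0 by apply: h2; rewrite ?inP_first.
  have : b %% N j = 0.
    by apply: hinj => //; rewrite h00; apply: (C_nth_inj j) e0 => //; apply: h1.
  by move=> /eqP bN; rewrite pE lj (mulnC b) dvdn_pmul2l.
Qed.

Lemma conc_refine_many j d w : w \in C (j + d) ->
  exists T g, (forall t, t < T -> g t \in C j) /\ (size w = T * l j /\
    forall i, i < size w -> nth true w i = conc (l j) g i).
Proof.
move=> hw.
suff: forall e, e <= d -> exists T g, (forall t, t < T -> g t \in C (j + (d - e))) /\
    (size w = T * l (j + (d - e)) /\
    forall i, i < size w -> nth true w i = conc (l (j + (d - e))) g i).
  by move=> /(_ d (leqnn d)); rewrite subnn addn0.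
elim=> [_|e IH ed].
  exists 1, (fun=> w); rewrite subn0; split=> //; rewrite mul1n (size_C_word _ _ hw).
  by split=> // i hi; rewrite /conc modn_small.
have [T [g [hg [sz gE]]]] := IH (ltnW ed).
have jE : j + (d - e) = (j + (d - e.+1)).+1 by lia.
rewrite jE in hg sz gE.
have [g' [hg' g'E]] := conc_refine _ _ _ hg.
exists (T * N (j + (d - e.+1))), g'; split=> //; split.
  by rewrite sz lenS mulnA mulnAC.
by move=> i hi; rewrite gE // g'E // -sz.
Qed.

(** * Parsing the points of the subshift *)

Lemma windowP x a n w :
  window x a n = w <-> size w = n /\ forall i, i < n -> x (a + i%:Z)%R = nth true w i.
Proof.
rewrite /window; split=> [<-|[sz h]].
  by split=> [|i hi]; rewrite ?size_mkseq // nth_mkseq.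
apply: (@eq_from_nth _ true); rewrite size_mkseq // => i hi.
by rewrite nth_mkseq // h.
Qed.

Lemma local_parse j x a n : subshift C x -> exists T g p,
  [/\ forall t, t < T -> g t \in C j, p + n <= T * l j &
      forall i, i < n -> x (a + i%:Z)%R = conc (l j) g (p + i)].
Proof.
(* Lengthening the window by [l j + 1] letters forces the word containing it to be longer than
   [l j], hence of level at least [j]. *)
move=> /(_ a (n + (l j).+1)) [k [w [wC /infixP [pre [post wE]]]]].
have sw : size (window x a (n + (l j).+1)) = n + (l j).+1 by rewrite size_mkseq.
have szw : size w = size pre + (n + (l j).+1 + size post) by rewrite wE !size_cat sw.
have jk : j <= k.
  rewrite leqNgt; apply/negP => /ltnW /len_le; rewrite -(size_C_word _ _ wC) szw; lia.
have kE : k = j + (k - j) by rewrite subnKC.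
rewrite kE in wC; have [T [g [hg [sz gE]]]] := conc_refine_many _ _ _ wC.
exists T, g, (size pre); split=> //; first by lia.
move=> i hi; rewrite -gE; last by lia.
rewrite wE nth_cat ltnNge leq_addr /= addKn nth_cat sw ifT; last by lia.
by rewrite nth_mkseq //; lia.
Qed.

(** Both occurrences lie in one finite concatenation of level [j] and are aligned there, so their
    distance is a multiple of the length. *)
Lemma parse_uniq j x a k : subshift C x ->
  window x a (l j) \in C j -> window x (a + k%:Z)%R (l j) \in C j -> l j %| k.
Proof.
move=> xX h1 h2; have [T [g [p [hg hp hi]]]] := local_parse j x a (k + l j) xX.
have d1 : l j %| p.
  apply: (word_aligned _ T g _ _ hg h1); first by lia.
  by move=> i il; rewrite -hi ?nth_mkseq //; lia.
have d2 : l j %| p + k.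
  apply: (word_aligned _ T g _ _ hg h2); first by lia.
  move=> i il; rewrite -addnA -hi ?nth_mkseq //; last by lia.
  by rewrite PoszD addrA.
by rewrite (dvdn_addr _ d1) in d2.
Qed.

Lemma parse_next j x a : subshift C x ->
  window x a (l j) \in C j -> window x (a + (l j)%:Z)%R (l j) \in C j.
Proof.
move=> xX h1; have [T [g [p [hg hp hi]]]] := local_parse j x a (l j + l j) xX.
have l0 := len_gt0 j.
have d1 : l j %| p.
  apply: (word_aligned _ T g _ _ hg h1); first by lia.
  by move=> i il; rewrite -hi ?nth_mkseq //; lia.
have [b pE] := dvdnP d1.
have hb : b.+1 < T by nia.
suff -> : window x (a + (l j)%:Z)%R (l j) = g b.+1 by apply: hg.
apply/windowP; split; first by rewrite (size_C_word _ _ (hg _ hb)).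
move=> i il; rewrite -addrA -PoszD hi; last by lia.
by rewrite pE addnA -mulSnr concE.
Qed.

Lemma parse_exists j x : subshift C x ->
  exists2 o, o < l j & window x (- o%:Z)%R (l j) \in C j.
Proof.
(* The window starts [l j] letters left of the origin, so the first word boundary strictly after its
   start is at [-(p mod l j)]. *)
move=> xX; have [T [g [p [hg hp hi]]]] := local_parse j x (- (l j)%:Z)%R (l j + l j) xX.
have l0 := len_gt0 j; have ho : p %% l j < l j by rewrite ltn_mod.
exists (p %% l j) => //.
have hb : (p %/ l j).+1 < T by move: hp; rewrite {1}(divn_eq p (l j)); nia.
suff -> : window x (- (p %% l j)%:Z)%R (l j) = g (p %/ l j).+1 by apply: hg.
apply/windowP; split; first by rewrite (size_C_word _ _ (hg _ hb)).
move=> i il.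
have -> : (- (p %% l j)%:Z + i%:Z = - (l j)%:Z + (l j - p %% l j + i)%N%:Z)%R by lia.
rewrite hi; last by lia.
have -> : p + (l j - p %% l j + i) = (p %/ l j).+1 * l j + i.
  by rewrite {1}(divn_eq p (l j)); nia.
by rewrite concE.
Qed.

Lemma subshift_shift x : subshift C x -> subshift C (sshift x).
Proof.
move=> xX a n; have [k [w [wC h]]] := xX (a + 1)%R n; exists k, w; split=> //.
suff -> : window (sshift x) a n = window x (a + 1)%R n by [].
by apply: eq_mkseq => i; rewrite /sshift addrAC.
Qed.

(** * Return times at unmarked positions *)

Lemma arrangement_window j x a f t :
  arrangement (C j) (l j) (window x a (l j.+1)) f -> t < N j ->
  window x (a + (t * l j)%:Z)%R (l j) = nth [::] (C j) (f t).
Proof.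
move=> [_ f1 _ _ f2] ht; apply/windowP; split.
  by apply: size_C_word; apply: mem_nth; apply: f1.
move=> i il; rewrite -f2 // nth_mkseq; last by rewrite lenS; nia.
by rewrite PoszD addrA.
Qed.

Lemma arrangement_bit j x a f i :
  arrangement (C j) (l j) (window x a (l j.+1)) f -> i < l j.+1 ->
  x (a + i%:Z)%R = nth true (nth [::] (C j) (f (i %/ l j))) (i %% l j).
Proof.
move=> hf il; have l0 := len_gt0 j.
have ht : i %/ l j < N j by rewrite ltn_divLR // mulnC -lenS.
have := arrangement_window _ _ _ _ _ hf ht => /windowP [_ <-]; last by rewrite ltn_mod.
by rewrite -addrA -PoszD -divn_eq.
Qed.

(** About [N^(1/4)]: unbounded, yet small against the typical spacing [N^(1/2)] of the markers. *)
Definition gap j := isqrt (isqrt (N j)).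

Lemma gap_bounds j : 2 ^ (j + 5) <= gap j /\
  [/\ gap j * gap j <= isqrt (N j), isqrt (N j) < (gap j).+1 * (gap j).+1,
      isqrt (N j) * isqrt (N j) <= N j & N j < (isqrt (N j)).+1 * (isqrt (N j)).+1].
Proof.
have [qN Nq] := andP (isqrtP (N j)).
have [mq qm] := andP (isqrtP (isqrt (N j))); rewrite -/(gap j) in mq qm *; split=> //.
have h1 : (2 ^ (2 * j + 10)) * 2 ^ (2 * j + 10) <= N j.
  by rewrite -expnD; apply: leq_trans (size_C_exp j); rewrite leq_exp2l //; lia.
have h2 : 2 ^ (2 * j + 10) <= isqrt (N j) by nia.
have h3 : 2 ^ (j + 5) * 2 ^ (j + 5) <= isqrt (N j).
  by rewrite -expnD; apply: leq_trans h2; rewrite leq_exp2l //; lia.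
by nia.
Qed.

Lemma gap_ge j : 32 <= gap j.
Proof.
have [+ _] := gap_bounds j; apply: leq_trans; rewrite expnD.
by rewrite -[32]/(2 ^ 5) leq_pmull // expn_gt0.
Qed.

Definition good_slot j b :=
  (b + gap j < N j) && all (fun t => ~~ inP (N j) t.+1) (iota b (gap j).+1).

(** [o] is the offset of the origin within the word of level [j+1] around it. *)
Definition good_at j (x : config) := exists o,
  [/\ o < l j.+1, good_slot j (o %/ l j) & window x (- o%:Z)%R (l j.+1) \in C j.+1].

Lemma R_good j x n : subshift C x -> good_at j x ->
  2 * l j <= n <= l j * gap j -> R_ x n = l j.+1.
Proof.
move=> xX [ o [oL /andP[bm /allP hP] hv]] /andP[n1 n2].
have l0 := len_gt0 j; have lj := lenS j; have m32 := gap_ge j.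
have L0 := len_gt0 j.+1.
have hv' := parse_next _ _ _ xX hv.
have [f hf] := C_arrangement _ _ hv; have [f' hf'] := C_arrangement _ _ hv'.
set b := o %/ l j in bm hP.
have oE := divn_eq o (l j); rewrite -/b in oE.
have ro : o %% l j < l j by rewrite ltn_mod.
have fix_ t : b <= t <= b + gap j -> [/\ t < N j, f t = t & f' t = t].
  move=> ht; have tP : ~~ inP (N j) t.+1 by apply: hP; rewrite mem_iota addnS ltnS.
  have tN : t < N j by lia.
  by have [_ _ _ h _] := hf; have [_ _ _ h' _] := hf'; rewrite h ?h'.
have retL : returns_at x n (l j.+1).
  rewrite /returns_at L0 /=; apply/eqP/windowP; split; first by rewrite size_mkseq.
  move=> i il; rewrite nth_mkseq // add0r.
  (* The bound [n <= l j * gap j] keeps the whole window in unmarked slots, where two consecutive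
     words of level [j+1] agree. *)
  have ht : b <= (o + i) %/ l j <= b + gap j.
    rewrite leq_div2r ?leq_addr //= -ltnS ltn_divLR //; nia.
  have [tN ft ft'] := fix_ _ ht.
  have oiL : o + i < l j.+1 by rewrite lj mulnC -ltn_divLR.
  have e1 : (i%:Z = - o%:Z + (o + i)%N%:Z)%R by lia.
  have e2 : ((l j.+1)%:Z + i%:Z = - o%:Z + (l j.+1)%:Z + (o + i)%N%:Z)%R by lia.
  by rewrite e2 [in RHS]e1 (arrangement_bit _ _ _ _ _ hf) // (arrangement_bit _ _ _ _ _ hf') // ft ft'.
have noret k : 0 < k < l j.+1 -> ~~ returns_at x n k.
  (* As [n >= 2 * l j], the window contains the whole slot [b+1]; an early return would repeat its
     word at distance [k]. *)
  move=> /andP[k0 kL]; apply/negP => /andP[_ /eqP ew].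
  have [b1N fb fb'] : [/\ b.+1 < N j, f b.+1 = b.+1 & f' b.+1 = b.+1] by apply: fix_; lia.
  have w1 := arrangement_window _ _ _ _ _ hf b1N; rewrite fb in w1.
  have uC : nth [::] (C j) b.+1 \in C j by apply: mem_nth.
  have w2 : window x (- o%:Z + (b.+1 * l j)%:Z + k%:Z)%R (l j) = nth [::] (C j) b.+1.
    rewrite -w1; apply/windowP; split; first by rewrite size_mkseq.
    move=> i il; rewrite nth_mkseq //.
    have hi : b.+1 * l j - o + i < n by rewrite {1}oE; nia.
    have := congr1 (fun w => nth true w (b.+1 * l j - o + i)) ew.
    rewrite !nth_mkseq // add0r.
    have ho : o <= b.+1 * l j by rewrite oE; nia.
    have -> : (k%:Z + (b.+1 * l j - o + i)%N%:Z = - o%:Z + (b.+1 * l j)%:Z + k%:Z + i%:Z)%R by lia.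
    by move=> ->; congr x; lia.
  have dk : l j %| k.
    by apply: (parse_uniq j x (- o%:Z + (b.+1 * l j)%:Z)%R) xX _ _; rewrite ?w1 ?w2.
  have [d kE] := dvdnP dk.
  have dN : 0 < d < N j by rewrite kE lj in k0 kL; nia.
  (* The repetition fills a slot of the same word or of the next one, and its index differs from
     [b+1] because [0 < d < N]; each word of level [j] fills only one slot of either. *)
  case: (ltnP (b.+1 + d) (N j)) => hbd.
  - have w3 := arrangement_window _ _ _ _ _ hf hbd.
    have pe : (- o%:Z + ((b.+1 + d) * l j)%:Z = - o%:Z + (b.+1 * l j)%:Z + k%:Z)%R by rewrite kE; lia.
    rewrite pe w2 in w3.
    have [_ f1 finj _ _] := hf.
    have e : b.+1 + d = b.+1.
      apply: finj => //; rewrite fb; apply: (C_nth_inj j); [exact: f1 | by [] | by []].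
    by lia.
  - have hbd' : b.+1 + d - N j < N j by lia.
    have w3 := arrangement_window _ _ _ _ _ hf' hbd'.
    have pe : (- o%:Z + (l j.+1)%:Z + ((b.+1 + d - N j) * l j)%:Z = - o%:Z + (b.+1 * l j)%:Z + k%:Z)%R.
      rewrite kE lj mulnBl; have : N j * l j <= (b.+1 + d) * l j by rewrite leq_mul2r hbd orbT.
      by lia.
    rewrite pe w2 in w3.
    have [_ f1 finj _ _] := hf'.
    have e : b.+1 + d - N j = b.+1.
      apply: finj => //; rewrite fb'; apply: (C_nth_inj j); [exact: f1 | by [] | by []].
    by lia.
rewrite /R_; case: pselect => [h|[]]; last by exists (l j.+1).
case: ex_minnP => k hk kmin.
apply/eqP; rewrite eqn_leq kmin //= leqNgt; apply/negP => kL.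
by have := noret k; rewrite kL hk andbT; case: (k) hk => [|k'] //= _ /(_ isT).
Qed.

Definition bad_offsets j := [seq o <- iota 0 (l j.+1) | ~~ good_slot j (o %/ l j)].

(** A bad slot lies at most [gap j] before a marker or the end of the word. With about [N^(1/2)]
    markers this leaves of the order of [N^(3/4)] bad slots among [N], and [gap j >= 2^(j+5)] turns
    the proportion into at most [2^-j]. *)
Lemma size_bad_offsets j : 2 ^ j * size (bad_offsets j) <= l j.+1.
Proof.
have [m2 [mq qm qN Nq]] := gap_bounds j; have l0 := len_gt0 j.
(* The entry [N j] stands for the end of the word; in [S] a bad slot is written as [p - d] with [p]
   in [P] and [d <= gap j]. *)
pose P := N j :: [seq val i | i <- enum (marker_set (N j))].
pose S := [seq (y.1 - y.2) * l j + r |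
  y : nat * nat <- [seq (p, d) | p <- P, d <- iota 0 (gap j).+1], r : nat <- iota 0 (l j)].
have N4 : 4 <= N j by apply: leq_trans (size_C_large j); rewrite -[4]/(2 ^ 2) leq_exp2l.
have szP : size P = (isqrt (N j)).+1 by rewrite /= size_map -cardE card_marker_set.
have szS : size S = (isqrt (N j)).+1 * (gap j).+1 * l j.
  by rewrite size_allpairs size_allpairs !size_iota szP.
have sub : size (bad_offsets j) <= size S.
  apply: uniq_leq_size; first by rewrite filter_uniq // iota_uniq.
  move=> o; rewrite mem_filter mem_iota /= add0n => /andP[hb oL].
  have bN : o %/ l j < N j by rewrite ltn_divLR // mulnC -lenS.
  have [p [pP hp]] : exists p, p \in P /\ o %/ l j <= p <= o %/ l j + gap j.
    move: hb; rewrite negb_and -leqNgt => /orP[hb|/allPn [t]].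
      by exists (N j); rewrite mem_head (ltnW bN).
    rewrite mem_iota addnS ltnS negbK => ht tP; have [tN|tN] := ltnP t (N j).
      exists t; split=> //; rewrite inE; apply/orP; right.
      by apply/mapP; exists (Ordinal tN) => //; rewrite mem_enum inE.
    by exists (N j); rewrite mem_head; split=> //; lia.
  apply/allpairsP; exists ((p, p - o %/ l j), o %% l j); split.
  - apply/allpairsP; exists (p, p - o %/ l j); split=> //.
    by rewrite mem_iota add0n /=; lia.
  - by rewrite mem_iota add0n /= ltn_mod.
  - by rewrite /= subKn; [exact: divn_eq | case/andP: hp].
apply: (@leq_trans (2 ^ j * size S)); first by rewrite leq_mul2l sub orbT.
rewrite szS {sub szS S szP P} lenS mulnA mulnC leq_mul2l; apply/orP; right.
rewrite expnD in m2; have m32 := gap_ge j.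
have q1 : (isqrt (N j)).+1 <= 2 * isqrt (N j) by nia.
have m1 : (gap j).+1 <= 2 * gap j by lia.
apply: leq_trans qN; apply: (@leq_trans (2 ^ j * (2 * isqrt (N j) * (2 * gap j)))).
  by rewrite leq_mul2l leq_mul ?orbT.
have : 2 ^ j * 4 * gap j <= isqrt (N j) by nia.
by nia.
Qed.

Lemma bad_offset j x : subshift C x -> ~ good_at j x ->
  exists2 o, o \in bad_offsets j & window x (- o%:Z)%R (l j.+1) \in C j.+1.
Proof.
move=> xX nG; have [ o oL hw] := parse_exists j.+1 _ xX; exists o => //.
by rewrite mem_filter mem_iota /= add0n oL andbT; apply/negP => g; apply: nG; exists o.
Qed.

(** * Counting windows *)

(* A window of length [n] meets at most two words of level [j.+1]; in each of
   them it covers at most [n %/ l j + 2] slots, and among these at most [K + 1]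
   marker positions (the extra one is the position 2). *)
Lemma window_list j n K : n <= l j.+1 -> n %/ l j + 2 <= K * K ->
  exists2 W : seq (seq bool), size W <= l j.+1 * N j ^ (2 * K.+1) &
    forall x, subshift C x -> window x 0%R n \in W.
Proof.
move=> nL hK; have l0 := len_gt0 j; have N0 := size_C_gt0 j; have lj := lenS j.
pose F := {ffun bool * 'I_K.+1 -> 'I_(N j)}.
(* A square [q * q] lying among the [K * K] slots that follow [base] is encoded
   by [q - isqrt base], which is at most [K]; [0] encodes the position 2. *)
pose q0 o (e : bool) := isqrt (if e then 0 else o %/ l j).
pose code (o : nat) (e : bool) (r : nat) : nat := if r == 1 then 0 else isqrt r.+1 - q0 o e.
pose uncode (o : nat) (e : bool) (k : nat) : nat := if k == 0 then 1 else ((k + q0 o e) * (k + q0 o e)).-1.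
(* [e] tells whether slot [t] lies in the second word. The table [T] lists the contents of the
   marker slots in both words; any other slot holds the word with its own index. *)
pose slot (o : nat) (T : F) (t : nat) : nat :=
  let e := N j <= t in let r := t %% N j in
  if inP (N j) r.+1 then val (T (e, inord (code o e r))) else r.
pose bit (o : nat) (T : F) (i : nat) : bool := nth true (nth [::] (C j) (slot o T ((o + i) %/ l j))) ((o + i) %% l j).
exists [seq mkseq (bit o T) n | o : nat <- iota 0 (l j.+1), T : F <- enum {: F}].
  rewrite size_allpairs size_iota -cardE card_ffun !card_ord card_prod card_bool card_ord.
  by rewrite leqnn.
move=> x xX; have [ o oL hv] := parse_exists j.+1 _ xX.
have hv' := parse_next _ _ _ xX hv.
have [f hf] := C_arrangement _ _ hv; have [f' hf'] := C_arrangement _ _ hv'.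
pose ff (e : bool) := if e then f' else f.
have [_ f1 _ f2 _] := hf; have [_ f1' _ f2' _] := hf'.
have ff1 e t : t < N j -> ff e t < N j by case: e; [apply: f1'|apply: f1].
have ff2 e t : t < N j -> ~~ inP (N j) t.+1 -> ff e t = t by case: e; [apply: f2'|apply: f2].
(* Codes that do not decode to a slot may yield an index outside the range; these entries default to
   0 and are never read. *)
pose T : F := [ffun y : bool * 'I_K.+1 => insubd (Ordinal N0) (ff y.1 (uncode o y.1 (val y.2)))].
have codeP e r : inP (N j) r.+1 -> r < N j ->
    (if e then 0 else o %/ l j) <= r <= (if e then 0 else o %/ l j) + n %/ l j + 1 ->
    code o e r < K.+1 /\ uncode o e (code o e r) = r.
  move=> rP rN; rewrite /code /uncode /q0; set base := if e then _ else _ => hr.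
  case: (r =P 1) => [->|r1]; first by rewrite eqxx.
  case: (inP_E _ _ rN rP) => [|[q2 qq]]; first by lia.
  have [b1 b2] := andP (isqrtP base); move: q2 qq b1 b2.
  set q := isqrt r.+1; set p := isqrt base => q2 qq b1 b2.
  have pq : p < q by nia.
  (* Indeed [q^2 = r + 1 <= base + K^2 < (p+1)^2 + K^2 <= (p+1+K)^2]. *)
  have qK : q - p <= K by nia.
  rewrite ifN; last by lia.
  by rewrite subnK ?qq //; lia.
have slotP e r : r < N j ->
    (if e then 0 else o %/ l j) <= r <= (if e then 0 else o %/ l j) + n %/ l j + 1 ->
    (if inP (N j) r.+1 then val (T (e, inord (code o e r))) else r) = ff e r.
  move=> rN hr; case: ifP => rP; last by rewrite ff2 ?rP.
  have [c1 c2] := codeP _ _ rP rN hr.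
  by rewrite ffunE /= inordK // c2 insubdK // unfold_in /= ff1.
apply/allpairsP; exists (o, T); split=> /=; first by rewrite mem_iota.
  by rewrite mem_enum.
apply/windowP; split; first by rewrite size_mkseq.
move=> i il; rewrite nth_mkseq // add0r /bit /slot.
have ho : o < N j * l j by rewrite mulnC -lj.
have hi : i <= n %/ l j * l j + (l j).-1.
  by have := divn_eq n (l j); have := ltn_pmod n l0; lia.
case: (ltnP ((o + i) %/ l j) (N j)) => ht.
- rewrite (modn_small ht) slotP //; last first.
    rewrite leq_div2r ?leq_addr //= -ltnS ltn_divLR //.
    by have := divn_eq o (l j); have := ltn_pmod o l0; nia.
  rewrite -(arrangement_bit _ _ _ _ _ hf); last by rewrite lj mulnC -ltn_divLR.
  by congr x; lia.
- have t2 : (o + i) %/ l j < N j + N j.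
    by rewrite ltn_divLR //; rewrite lj in nL; nia.
  have tE : (o + i) %/ l j %% N j = (o + i) %/ l j - N j.
    rewrite -{1}(subnK ht) modnDr modn_small //; lia.
  have t3 : (o + i) %/ l j < N j + n %/ l j + 2.
    by rewrite ltn_divLR //; nia.
  rewrite tE slotP; [|lia|lia].
  have oi : l j.+1 <= o + i by rewrite lj mulnC; rewrite leq_divRL in ht.
  have dE : o + i = (o + i - l j.+1) + N j * l j by rewrite mulnC -lj; lia.
  have -> : (o + i) %/ l j - N j = (o + i - l j.+1) %/ l j.
    by rewrite {1}dE divnDMl // addnK.
  have -> : (o + i) %% l j = (o + i - l j.+1) %% l j by rewrite {1}dE addnC modnMDl.
  rewrite -(arrangement_bit _ _ _ _ _ hf'); last by lia.
  by congr x; lia.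
Qed.

Lemma R_le x n k : returns_at x n k -> R_ x n <= k.
Proof. by move=> h; rewrite /R_; case: pselect => // h'; case: ex_minnP => m _; apply. Qed.

(** * Almost sure behaviour *)

Section Measure.
Context (R : realType) (mu : probability Omega R).
Hypothesis muX : mu (subshift C) = 1%E.
Hypothesis mu_inv : forall A : set Omega, measurable A ->
  mu ((sshift : Omega -> Omega) @^-1` A)%classic = mu A.

Let mX : measurable (subshift C : set Omega) := measurable_subshift C.

(** Unique parsing forbids two words of level [j] starting at distance less than [l j], so
    [measure_no_return] applies with [K = l j]. *)
Lemma measure_word_at j (o : nat) :
  (mu [set x | window x (- o%:Z)%R (l j) \in C j]%classic <= ((l j)%:R^-1)%:E)%E.
Proof.
apply: (measure_no_return mu mu_inv (subshift C)) => //; first exact: len_gt0.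
- by apply: (measurable_local (- o%:Z)%R (l j)) => x y /= ->.
- exact: subshift_shift.
- move=> x i xX /= h1 /andP[i0 il]; rewrite window_iter_shift => h2.
  by have := dvdn_leq i0 (parse_uniq _ _ _ _ xX h1 h2); rewrite leqNgt il.
Qed.

Definition bad j : set Omega := (subshift C `&` ~` [set x | good_at j x])%classic.

Lemma measurable_good j : measurable ([set x | good_at j x]%classic : set Omega).
Proof.
apply: (measurable_local (- (l j.+1)%:Z)%R (l j.+1 + l j.+1)) => x y e [ o [ oL g h]].
exists o; split=> //.
have oE : (- o%:Z = - (l j.+1)%:Z + (l j.+1 - o)%N%:Z)%R by lia.
by rewrite oE -(window_sub _ _ _ _ _ _ e) -?oE //; lia.
Qed.

Lemma measurable_bad j : measurable (bad j).
Proof. by apply: measurableI => //; apply: measurableC; apply: measurable_good. Qed.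

Lemma measure_bad j : (mu (bad j) <= ((2 ^ j)%:R^-1)%:E)%E.
Proof.
have L0 : (0 < (l j.+1)%:R :> R)%R by rewrite ltr0n len_gt0.
apply: (@le_trans _ _ ((size (bad_offsets j))%:R%:E * ((l j.+1)%:R^-1)%:E)%E).
  apply: (measure_seq_union mu _ (bad_offsets j) _
    (fun o => [set x | window x (- o%:Z)%R (l j.+1) \in C j.+1]%classic)).
  - exact: measurable_bad.
  - by move=> o _; apply: (measurable_local (- o%:Z)%R (l j.+1)) => x y /= ->.
  - by move=> x [xX /= nG]; apply: bad_offset.
  - by move=> o _; apply: measure_word_at.
rewrite -EFinM lee_fin ler_pdivrMr // ler_pdivlMl ?ltr0n ?expn_gt0 //.
by rewrite -natrM ler_nat size_bad_offsets.
Qed.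

(** * Late returns *)

Definition late n Q : set Omega :=
  [set x | subshift C x /\ forall k, (0 < k < Q) -> ~~ returns_at x n k]%classic.

Lemma measurable_norecur n Q w : measurable ([set x | window x 0%R n = w /\
  forall k, (0 < k < Q) -> ~~ returns_at x n k]%classic : set Omega).
Proof.
apply: (measurable_local 0%R (Q + n)) => x y e [<- h].
have e0 k : k <= Q -> window x k%:Z n = window y k%:Z n.
  by move=> kQ; have := window_sub _ _ _ _ k n e; rewrite add0r; apply; lia.
split; first by rewrite (e0 0).
by move=> k hk; have := h k hk; rewrite /returns_at (e0 0) // e0 //; lia.
Qed.

Lemma measurable_late n Q : measurable (late n Q).
Proof.
have -> : late n Q = (subshift C `&` \bigcup_w [set x | window x 0%R n = w /\
    forall k, (0 < k < Q) -> ~~ returns_at x n k])%classic.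
  apply/seteqP; split=> x; first by move=> [xX h]; split=> //; exists (window x 0%R n).
  by move=> [xX [w _ [_ h]]].
apply: measurableI => //; apply: countable_bigcupT_measurable => // w.
exact: measurable_norecur.
Qed.

(** For one fixed word, the points that show it and do not return before time [Q] have measure at
    most [1/Q]; these bounds are added over [W]. *)
Lemma measure_late n Q (W : seq (seq bool)) a :
  (forall x, subshift C x -> window x 0%R n \in W) ->
  0 < Q -> 0 < a -> size W * a <= Q -> (mu (late n Q) <= (a%:R^-1)%:E)%E.
Proof.
move=> hW Q0 a0 hQ.
apply: (@le_trans _ _ ((size W)%:R%:E * (Q%:R^-1)%:E)%E).
  apply: (measure_seq_union mu _ W _ (fun w => [set x | window x 0%R n = w /\
    forall k, (0 < k < Q) -> ~~ returns_at x n k]%classic)).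
  - exact: measurable_late.
  - by move=> w _; apply: measurable_norecur.
  - by move=> x [xX h]; exists (window x 0%R n) => //; apply: hW.
  - move=> w _; apply: (measure_no_return mu mu_inv (subshift C)) => //.
    + exact: measurable_norecur.
    + exact: subshift_shift.
    + move=> x i xX [w1 h1] hi [w2 _]; rewrite window_iter_shift add0r in w2.
      by have := h1 i hi; rewrite /returns_at w2 w1 eqxx andbT; case/andP: hi => ->.
rewrite -EFinM lee_fin ler_pdivrMr ?ltr0n // ler_pdivlMl ?ltr0n //.
by rewrite -natrM ler_nat mulnC.
Qed.

Lemma measure_setD0 (B : set Omega) : measurable B -> mu B = 0%E ->
  measurable (subshift C `\` B : set Omega)%classic /\ mu (subshift C `\` B)%classic = 1%E.
Proof.
move=> mB B0; have mCB := measurableC mB; split; first exact: measurableD.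
rewrite setDE setIC measure_inter_full // probability_setC // B0 sube0 //.
Qed.

Lemma ae_good : exists2 A : set Omega,
  [/\ measurable A, (A `<=` subshift C)%classic & mu A = 1%E] &
  forall x, A x -> exists J, forall j, J <= j -> good_at j x.
Proof.
have mL : measurable (lim_sup_set bad).
  by apply: bigcap_measurable => // k _; apply: bigcup_measurable => i _; apply: measurable_bad.
have L0 : mu (lim_sup_set bad) = 0%E.
  apply: (measure_lim_sup0 mu bad (fun j => (2 ^ j)%:R^-1)%R 2%:R measurable_bad measure_bad).
  move=> n; suff -> : (\sum_(0 <= i < n) (2 ^ i)%:R^-1 = 2 - 2 / (2 ^ n)%:R :> R)%R.
    by rewrite gerBl divr_ge0 ?ler0n.
  elim: n => [|n IH]; first by rewrite big_geq // expn0 divr1 subrr.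
  rewrite big_nat_recr //= IH expnS natrM.
  have : ((2 ^ n)%:R != 0 :> R)%R by rewrite pnatr_eq0 -lt0n expn_gt0.
  by move=> h; field.
have [mA A1] := measure_setD0 _ mL L0.
exists (subshift C `\` lim_sup_set bad)%classic; first by split=> // x [].
move=> x [xX nL].
apply: contrapT => nJ; apply: nL => J _; apply: contrapT => nB; apply: nJ.
by exists J => j hj; apply: contrapT => ng; apply: nB; exists j.
Qed.

(** The factor [(n+1)(n+2)] makes the measures of late returns at most the terms of a telescoping
    series; the successor of the size keeps the threshold positive. Positivity of [R_] records that
    a return exists, 0 being its default. *)
Lemma ae_return (W : nat -> seq (seq bool)) :
  (forall n x, subshift C x -> window x 0%R n \in W n) ->
  exists2 A : set Omega,
  [/\ measurable A, (A `<=` subshift C)%classic & mu A = 1%E] &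
  forall x, A x -> exists n0, forall n, n0 <= n ->
    0 < R_ x n <= (size (W n)).+1 * (n.+1 * n.+2).
Proof.
move=> hW; pose Q n := (size (W n)).+1 * (n.+1 * n.+2).
pose F n := late n (Q n).
have mF n : measurable (F n) by apply: measurable_late.
have mL : measurable (lim_sup_set F).
  by apply: bigcap_measurable => // k _; apply: bigcup_measurable => i _.
have L0 : mu (lim_sup_set F) = 0%E.
  apply: (measure_lim_sup0 mu F (fun n => (n.+1 * n.+2)%:R^-1)%R 1%R mF).
    by move=> n; apply: measure_late (hW n) _ _ _ => //; rewrite leq_mul2r leqnSn orbT.
  move=> n; suff -> : (\sum_(0 <= i < n) (i.+1 * i.+2)%:R^-1 = 1 - 1 / n.+1%:R :> R)%R.
    by rewrite gerBl divr_ge0 ?ler0n.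
  elim: n => [|n IH]; first by rewrite big_geq // divr1 subrr.
  rewrite big_nat_recr //= IH natrM -[(n.+2%:R)%R]natr1.
  have h1 : (n.+1%:R != 0 :> R)%R by rewrite pnatr_eq0.
  have h2 : (n.+1%:R + 1 != 0 :> R)%R by rewrite natr1 pnatr_eq0.
  by move: (n.+1%:R)%R h1 h2 => y h1 h2; field; rewrite h1 h2.
have [mA A1] := measure_setD0 _ mL L0.
exists (subshift C `\` lim_sup_set F)%classic; first by split=> // x [].
move=> x [xX nL].
apply: contrapT => nJ; apply: nL => J _; apply: contrapT => nB; apply: nJ.
exists J => n hn; apply: contrapT => ng; apply: nB; exists n => //; split=> // k /andP[k0 kQ].
apply/negP => hk; apply: ng; apply/andP; split; last first.
  by apply: leq_trans (R_le _ _ _ hk) _; apply: ltnW.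
rewrite /R_; case: pselect => [h|[]]; last by exists k.
by case: ex_minnP => m /andP[].
Qed.

End Measure.

(** * Asymptotics of lengths and counts *)

Section Growth.
Import numFieldNormedType.Exports.
Local Open Scope ring_scope.
Local Open Scope classical_set_scope.
Context {R : realType}.

Lemma natr_gt0 n : (0 < n)%N -> 0 < n%:R :> R. Proof. by rewrite ltr0n. Qed.

Lemma ln_nat_le m n : (0 < m <= n)%N -> ln m%:R <= ln n%:R :> R.
Proof.
move=> /andP[m0 mn]; rewrite ler_ln ?posrE ?ltr0n ?ler_nat //.
exact: leq_trans mn.
Qed.

Lemma ln_nat_ge0 m : 0 <= ln m%:R :> R.
Proof. by case: m => [|m]; [rewrite ln0 | apply: ln_ge0; rewrite ler1n]. Qed.

(** At level 0 this is [N = 2^s] with [s] the root of the length. With [q] the integer root of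
    [N j], [ln (q!) <= q ln q], where [q] is at most the root of [N j] and [ln q <= ln (N j)] is at
    most the root of [l j]. *)
Lemma ln_size_le j : ln (N j)%:R <= Num.sqrt (l j)%:R :> R.
Proof.
elim: j => [|j IH].
  rewrite size_C0 /= l1E natrX lnXn ?ltr0n // natrM -expr2 sqrtr_sqr ger0_norm ?ler0n //.
  rewrite -[ln 2 *+ s]mulr_natr -[leRHS]mul1r ler_wpM2r ?ler0n //.
  by have := @le_ln1Dx R 1; rewrite -natr1 addrC; apply; lra.
have [_ [_ _ qN _]] := gap_bounds j; have N0 := size_C_gt0 j.
have q0 : (0 < isqrt (N j))%N.
  by have [m1 [m2 _ _ _]] := gap_bounds j; have := gap_ge j; nia.
rewrite size_C_succ lenS natrM sqrtrM ?ler0n //.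
apply: (@le_trans _ _ ((isqrt (N j))%:R * ln (isqrt (N j))%:R)).
  rewrite mulr_natl -lnXn ?ltr0n // -natrX; apply: ln_nat_le.
  by rewrite fact_gt0 fact_upper.
rewrite mulrC ler_pM ?ler0n ?ln_nat_ge0 //.
  by apply: le_trans IH; apply: ln_nat_le; rewrite q0 /=; nia.
by rewrite -[leLHS]ger0_norm ?ler0n // -sqrtr_sqr ler_sqrt ?ler0n // -natrX ler_nat -mulnn.
Qed.

Lemma level_of n : (l 0 <= n)%N -> exists j, (l j <= n <= l j.+1)%N.
Proof.
move=> hn; have ex : exists j, (n < l j)%N by exists n; apply: len_gt_index.
case: (ex_minnP ex) => -[|j] hj jmin; first by rewrite ltnNge hn in hj.
exists j; rewrite (ltnW hj) andbT leqNgt; apply/negP => /jmin.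
by rewrite ltnn.
Qed.

Lemma window_count n : (l 0 <= n)%N -> exists W : seq (seq bool),
  (forall x, subshift C x -> window x 0 n \in W) /\
  ln ((size W).+1 * (n.+1 * n.+2))%:R <= 22 * Num.sqrt n%:R :> R.
Proof.
move=> hn; have [j /andP[jn nj]] := level_of _ hn.
have l0 := len_gt0 j; have N0 := size_C_gt0 j.
pose k := isqrt (n %/ l j + 2).
have [k1 k2] := andP (isqrtP (n %/ l j + 2)); rewrite -/k in k1 k2.
have [W sW hW] := window_list j n k.+1 nj (ltnW k2).
exists W; split=> //.
have n3 : (3 <= n)%N by apply: leq_trans jn; apply: len_ge3.
have sW' : ((size W).+1 <= 2 * (l j.+1 * N j ^ (2 * k.+2)))%N.
  have : (0 < l j.+1 * N j ^ (2 * k.+2))%N by rewrite muln_gt0 len_gt0 expn_gt0 N0.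
  by lia.
set r := Num.sqrt n%:R.
have r1 : 1 <= r by rewrite -[leLHS]sqrtr1 ler_sqrt ?ler0n // ler1n; lia.
have lr : Num.sqrt (l j)%:R <= r by rewrite ler_sqrt ?ler0n // ler_nat.
have lnN : ln (N j)%:R <= Num.sqrt (l j)%:R :> R := ln_size_le j.
have ln4 m : (0 < m <= 4 * n)%N -> ln m%:R <= 4 * r.
  move=> /andP[m0 mn]; apply: (le_trans (ln_le_sqrt _ (natr_gt0 _ m0))).
  have : Num.sqrt m%:R <= 2 * r; last by lra.
  have -> : 2 * r = Num.sqrt (4 * n)%:R.
    rewrite natrM sqrtrM ?ler0n //; congr (_ * _).
    by rewrite (_ : 4%:R = 2 ^+ 2) ?sqrtr_sqr ?ger0_norm //; ring.
  by rewrite ler_sqrt ?ler0n // ler_nat.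
have lnl : ln (l j)%:R <= 4 * r by apply: ln4; rewrite l0 /=; lia.
(* Here [k^2 * l j <= n + 2 * l j <= 4n]: the roughly [2k] markers met cost [ln (N j)] each, which
   totals a multiple of the root of [n]. *)
have kr : k%:R * Num.sqrt (l j)%:R <= 2 * r.
  have e1 : 2 * r = Num.sqrt (4 * n)%:R.
    rewrite natrM sqrtrM ?ler0n //; congr (_ * _).
    by rewrite (_ : 4%:R = 2 ^+ 2) ?sqrtr_sqr ?ger0_norm //; ring.
  have e2 : k%:R * Num.sqrt (l j)%:R = Num.sqrt (k * k * l j)%:R :> R.
    by rewrite (natrM _ (k * k)) natrM sqrtrM ?mulr_ge0 ?ler0n // -expr2 sqrtr_sqr ger0_norm ?ler0n.
  rewrite e1 e2 ler_sqrt ?ler0n // ler_nat.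
  have := divn_eq n (l j); nia.
have P1 : (0 < l j.+1 * N j ^ (2 * k.+2))%N by rewrite muln_gt0 len_gt0 expn_gt0 N0.
apply: (@le_trans _ _ (ln (2 * (l j * N j * N j ^ (2 * k.+2)) * (n.+1 * n.+2))%:R)).
  by apply: ln_nat_le; rewrite muln_gt0 //= leq_mul2r sW' orbT.
have lnE : ln (N j ^ (2 * k.+2))%:R = ln (N j)%:R *+ (2 * k.+2) :> R.
  by rewrite natrX lnXn ?ltr0n.
have E0 : (0 < N j ^ (2 * k.+2))%N by rewrite expn_gt0 N0.
move: (N j ^ (2 * k.+2))%N lnE E0 => E lnE E0.
rewrite !natrM !lnM ?posrE ?mulr_gt0 ?ltr0n // lnE.
have h2 : ln 2 <= r by apply: le_trans r1; have := @le_ln1Dx R 1; rewrite -natr1 addrC; apply; lra.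
have h3 : ln n.+1%:R <= 4 * r by apply: ln4; lia.
have h4 : ln n.+2%:R <= 4 * r by apply: ln4; lia.
have h5 : ln (N j)%:R *+ (2 * k.+2) <= 8 * r.
  rewrite -[ln _ *+ _]mulr_natl natrM -[k.+2%:R]natr1 -[k.+1%:R]natr1.
  have k0 : 0 <= k%:R :> R by apply: ler0n.
  have := ler_wpM2l k0 lnN; lra.
(* In units of [r], the factors 2, [l j], [N j], [E], [n+1], [n+2] contribute 1 + 4 + 1 + 8 + 4 + 4
   = 22. *)
lra.
Qed.

(** From [q! >= 2^(q-1)] and [ln 2 >= 1/2], as [(q-1)/2 >= q/4]. *)
Lemma ln_size_ge j : (isqrt (N j))%:R / 4 <= ln (N j.+1)%:R :> R.
Proof.
have q32 : (32 <= isqrt (N j))%N.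
  by have [m1 [m2 _ _ _]] := gap_bounds j; have := gap_ge j; nia.
rewrite size_C_succ.
apply: (@le_trans _ _ (ln (2 ^ (isqrt (N j)).-1)%:R)); last first.
  by apply: ln_nat_le; rewrite expn_gt0 /= fact_pow2_lower.
rewrite natrX lnXn ?ltr0n // -[ln _ *+ _]mulr_natl.
have h : ((isqrt (N j)).-1)%:R = (isqrt (N j))%:R - 1 :> R.
  by rewrite -subn1 natrB //; lia.
have h1 : 0 <= ((isqrt (N j)).-1)%:R :> R by apply: ler0n.
have := ler_wpM2l h1 (@ln2_ge R); have h32 : 32 <= (isqrt (N j))%:R :> R by rewrite ler_nat.
rewrite h; lra.
Qed.

Lemma log_len_ge j : ln (N j)%:R <= ln (l j.+1)%:R :> R.
Proof. by apply: ln_nat_le; rewrite size_C_gt0 lenS leq_pmull // len_gt0. Qed.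

Lemma isqrt_size_cvgy : (fun j => (isqrt (N j))%:R : R) @ \oo --> +oo.
Proof.
apply: ger_cvgy cvgr_idn; apply: nearW => j; rewrite ler_nat.
have [m1 [m2 _ _ _]] := gap_bounds j.
have a1 : (j <= 2 ^ j)%N by apply: ltnW; apply: ltn_expl.
have a2 : (2 ^ j <= 2 ^ (j + 5))%N by rewrite leq_exp2l // leq_addr.
apply: leq_trans (leq_trans a1 a2) _; apply: leq_trans m1 _; apply: leq_trans m2.
by rewrite leq_pmulr //; apply: leq_trans (gap_ge j).
Qed.

Lemma len_cvgy : (fun j => (l j)%:R : R) @ \oo --> +oo.
Proof.
apply: ger_cvgy cvgr_idn; apply: nearW => j; rewrite ler_nat.
by apply: ltnW; apply: len_gt_index.
Qed.

Lemma cvgy_shift (u : nat -> R) : (fun j => u j.+1) @ \oo --> +oo -> u @ \oo --> +oo.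
Proof.
move=> /cvgryPge h; apply/cvgryPge => A; have [J _ hJ] := h A.
by exists J.+1 => // -[|j] //=; rewrite ltnS => /hJ.
Qed.

Lemma log_len_cvgy : (fun j => ln (l j.+1)%:R : R) @ \oo --> +oo.
Proof.
have c0 : 0 < 4^-1 :> R by rewrite invr_gt0.
have hq : (fun j => (isqrt (N j))%:R * 4^-1 : R) @ \oo --> +oo.
  by apply: cvgy_mulr c0 _; apply: isqrt_size_cvgy.
apply: cvgy_shift; apply: ger_cvgy hq.
by apply: nearW => j; apply: le_trans (log_len_ge _); apply: ln_size_ge.
Qed.

(* Eventually [l (j+1)] is at most [(2q)^(2+2/k)] with [q = isqrt (N j)], while
   [ln (N (j+1)) >= q / 4]. *)
Lemma log_len_dominates b : 0 < b -> b < 1 / 2 ->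
  (fun j => ln (l j.+1)%:R / (2 * l j)%:R `^ b : R) @ \oo --> +oo.
Proof.
move=> b0 b2.
have [k k0 hk] : exists2 k, (0 < k)%N & 2 * b * (1 + k%:R^-1) < 1.
  have d0 : 0 < 1 - 2 * b by lra.
  exists (Num.truncn (2 * b / (1 - 2 * b))).+1 => //.
  have := truncnS_gt (2 * b / (1 - 2 * b)); set K := _.+1 => hK.
  have K0 : 0 < K%:R :> R by rewrite ltr0n.
  rewrite mulrDr mulr1 -ltrBrDl ltr_pdivrMr // -ltr_pdivrMl //.
  by rewrite mulrC.
(* [z^g] bounds the power [b] of the length, and [g < 1] leaves a factor [z^(1-g)] tending to
   infinity. *)
pose g := 2 * b * (1 + k%:R^-1).
have g1 : 0 < 1 - g by rewrite subr_gt0.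
have [J hJ] := len_pow_le_size k.
pose z j : R := (2 * isqrt (N j))%:R.
have z0 j : 0 < z j.
  rewrite ltr0n muln_gt0 /=; have [m1 [m2 _ _ _]] := gap_bounds j; have := gap_ge j; nia.
have zy : z @ \oo --> +oo.
  apply: ger_cvgy isqrt_size_cvgy; apply: nearW => j; rewrite ler_nat; lia.
apply: cvgy_shift.
have c0 : 0 < (8 * 2 `^ b)^-1 :> R by rewrite invr_gt0 mulr_gt0 ?powR_gt0 ?ltr0n.
have hz : (fun j => z j `^ (1 - g) * (8 * 2 `^ b)^-1) @ \oo --> +oo.
  by apply: cvgy_mulr c0 _; apply: cvgy_powR.
apply: ger_cvgy hz.
exists J => // j Jj; have hj := hJ j Jj.
have [_ [_ _ qN Nq]] := gap_bounds j.
have q0 : (0 < isqrt (N j))%N by have := z0 j; rewrite ltr0n muln_gt0.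
have hl : ((l j.+1) ^ k <= (2 * isqrt (N j)) ^ (2 * k.+1))%N.
  rewrite lenS expnMn; apply: (@leq_trans (N j ^ k.+1)).
    by rewrite expnS leq_mul2r hj orbT.
  by rewrite expnM; apply: leq_expl; rewrite -mulnn; nia.
have l0 : 0 < (l j.+1)%:R :> R by rewrite ltr0n len_gt0.
have hlb : (2 * l j.+1)%:R `^ b <= 2 `^ b * z j `^ g.
  rewrite natrM powRM ?ler0n // ler_pM2l ?powR_gt0 ?ltr0n //.
  have kr0 : k%:R != 0 :> R by rewrite pnatr_eq0 -lt0n.
  have e1 : (l j.+1)%:R `^ b = ((l j.+1) ^ k)%:R `^ (b / k%:R).
    rewrite natrX -powR_mulrn ?ler0n // -powRrM; congr (_ `^ _); field; exact: kr0.
  have e2 : z j `^ g = ((2 * isqrt (N j)) ^ (2 * k.+1))%:R `^ (b / k%:R).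
    rewrite natrX -powR_mulrn ?ler0n // -powRrM; congr (_ `^ _).
    rewrite /g natrM -[k.+1%:R]natr1; field; exact: kr0.
  rewrite e1 e2; apply: ge0_ler_powR; rewrite ?nnegrE ?ler0n ?ler_nat //.
  by rewrite divr_ge0 ?ler0n ?ltW.
have ln_ge : z j / 8 <= ln (l j.+2)%:R.
  apply: le_trans (log_len_ge _); apply: le_trans (ln_size_ge _).
  by rewrite /z natrM; lra.
rewrite ler_pdivlMr; last by rewrite powR_gt0 // ltr0n muln_gt0 len_gt0.
apply: le_trans ln_ge.
have zg : z j `^ (1 - g) * z j `^ g = z j.
  by rewrite -powRD ?subrK ?powRr1 ?(ltW (z0 j)) // (gt_eqF (z0 j)) implybT.
have w0 : 0 <= z j `^ (1 - g) / (8 * 2 `^ b) by rewrite divr_ge0 ?powR_ge0 ?mulr_ge0 ?powR_ge0 ?ler0n.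
apply: (le_trans (ler_wpM2l w0 hlb)).
rewrite -{3}zg le_eqVlt; apply/orP; left; apply/eqP.
have : 2 `^ b != 0 :> R by rewrite gt_eqF // powR_gt0 ltr0n.
move: (2 `^ b) => y y0; field; exact: y0.
Qed.

(** [N] is at most [(2 * gap j)^4]; thus the logarithm of the next length is at most four times that
    of [2 * (l j * gap j)]. *)
Lemma len_le_gap j : (l j.+1 <= (2 * (l j * gap j)) ^ 4)%N.
Proof.
have [_ [m1 m2 qN Nq]] := gap_bounds j; have l0 := len_gt0 j; have m32 := gap_ge j.
have hq : ((isqrt (N j)).+1 <= 4 * (gap j * gap j))%N by nia.
have hN : (N j <= (4 * (gap j * gap j)) * (4 * (gap j * gap j)))%N.
  by apply: leq_trans (ltnW Nq) _; apply: leq_mul.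
have e : ((2 * (l j * gap j)) ^ 4 = (l j * l j * l j * l j) * ((4 * (gap j * gap j)) * (4 * (gap j * gap j))))%N.
  by rewrite -[4%N]/(2 * 2)%N expnM -!mulnn; ring.
by rewrite e lenS; apply: leq_mul => //; rewrite -!mulnA leq_pmulr // !muln_gt0 l0.
Qed.

Lemma log_len_small b : 0 < b ->
  (fun j => ln (l j.+1)%:R / (l j * gap j)%:R `^ b : R) @ \oo --> (0 : R).
Proof.
move=> b0; pose u j : R := (2 * (l j * gap j))%:R.
have uy : u @ \oo --> +oo.
  apply: ger_cvgy len_cvgy; apply: nearW => j; rewrite ler_nat.
  by have := gap_ge j; nia.
have h := cvg0_ln_powR _ _ b0 uy.
have h' : (fun j => (4 * 2 `^ b) * (ln (u j) / u j `^ b)) @ \oo --> (0 : R).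
  by rewrite -[X in _ --> X](mulr0 (4 * 2 `^ b)); apply: cvgM => //; apply: cvg_cst.
apply: cvg0_le h'; apply: nearW => j.
rewrite divr_ge0 ?ln_nat_ge0 ?powR_ge0 //=.
have M0 : (0 < l j * gap j)%N by have := gap_ge j; have := len_gt0 j; nia.
have u0 : 0 < u j by rewrite ltr0n muln_gt0.
have hln : ln (l j.+1)%:R <= 4 * ln (u j).
  rewrite mulr_natl -lnXn // -natrX; apply: ln_nat_le.
  by rewrite len_gt0 len_le_gap.
have eu : u j `^ b = 2 `^ b * (l j * gap j)%:R `^ b.
  by rewrite /u natrM powRM ?ler0n.
have p0 : 0 < (l j * gap j)%:R `^ b :> R by rewrite powR_gt0 // ltr0n.
have t0 : 0 < 2 `^ b :> R by rewrite powR_gt0 // ltr0n.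
rewrite eu ler_pdivrMr //; apply: (le_trans hln).
rewrite le_eqVlt; apply/orP; left; apply/eqP.
move: (2 `^ b) t0 ((l j * gap j)%:R `^ b) p0 => y y0 v v0; field.
by rewrite !gt_eqF.
Qed.

End Growth.

(** * Critical values *)

Section ReturnTimes.
Import numFieldNormedType.Exports.
Local Open Scope ring_scope.
Local Open Scope classical_set_scope.
Context {R : realType}.

(** The target is [n = (ln l)^(1/tau)] with [l] the length of level [j+1], so that [ln R_n] is about
    [n^tau]; it is clamped to the range where [R_good] applies. For [tau = 0] the upper end serves,
    as it outgrows every power of that logarithm. *)
Definition scale (tau : R) (j : nat) : nat :=
  if tau == 0 then (l j * gap j)%N else
  minn (l j * gap j) (maxn (2 * l j) (Num.truncn (ln (l j.+1)%:R `^ tau^-1)).+1).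

Lemma scale_bounds tau j : (2 * l j <= scale tau j <= l j * gap j)%N.
Proof.
have h : (2 * l j <= l j * gap j)%N by have := gap_ge j; nia.
rewrite /scale; case: ifP => _; first by rewrite h leqnn.
by rewrite leq_min h leq_maxl geq_minl.
Qed.

Lemma scale_mono tau : {homo scale tau : i j / (i < j)%N}.
Proof.
apply: homo_ltn; first exact: ltn_trans.
move=> j; have /andP[_ h1] := scale_bounds tau j; have /andP[h2 _] := scale_bounds tau j.+1.
apply: leq_ltn_trans h1 _; apply: leq_trans h2; rewrite lenS.
have [_ [mq _ qN _]] := gap_bounds j; have l0 := len_gt0 j; have m32 := gap_ge j.
have mN : (gap j <= N j)%N.
  have g1 : (gap j <= isqrt (N j))%N by apply: leq_trans mq; rewrite leq_pmulr //; lia.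
  by apply: leq_trans qN; apply: leq_trans g1 _; rewrite leq_pmulr //; lia.
have : (l j * gap j <= l j * N j)%N by rewrite leq_mul2l mN orbT.
have : (0 < l j * N j)%N by rewrite muln_gt0 l0 size_C_gt0.
by lia.
Qed.

Lemma scale_gt0 tau j : 0 < (scale tau j)%:R :> R.
Proof.
rewrite ltr0n; have /andP[+ _] := scale_bounds tau j; apply: leq_trans.
by rewrite muln_gt0 len_gt0.
Qed.

(** The scale is the upper end, handled by [log_len_small], or at least the target, where the
    quotient is at most a negative power of the logarithm. The sum of both bounds covers either
    case. *)
Lemma scale_above tau b : 0 <= tau -> tau < b ->
  (fun j => ln (l j.+1)%:R / (scale tau j)%:R `^ b) @ \oo --> (0 : R).
Proof.
move=> t0 tb; have b0 : 0 < b by apply: le_lt_trans tb.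
have hM := log_len_small (R := R) _ b0.
have [tau0|tau0] := eqVneq tau 0.
  by rewrite /scale tau0 eqxx; exact: hM.
have tpos : 0 < tau by rewrite lt0r tau0.
have e0 : 0 < b / tau - 1 by rewrite subr_gt0 ltr_pdivlMr // mul1r.
have hL := cvg0_inv _ (cvgy_powR _ _ e0 (@log_len_cvgy R)).
have hS : (fun j => ln (l j.+1)%:R / (l j * gap j)%:R `^ b +
    (ln (l j.+1)%:R `^ (b / tau - 1))^-1) @ \oo --> (0 : R).
  by rewrite -[X in _ --> X](addr0 (0 : R)); apply: cvgD.
apply: cvg0_le hS.
have := @log_len_cvgy R => /cvgryPge /(_ 1); apply: filterS => j L1.
have L0 : 0 < ln (l j.+1)%:R :> R by apply: lt_le_trans L1.
apply/andP; split; first by rewrite divr_ge0 ?powR_ge0 ?(ltW L0).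
have M0 : 0 < (l j * gap j)%:R :> R by have := scale_gt0 0 j; rewrite /scale eqxx.
have mono (x y : R) : 0 < x -> x <= y -> ln (l j.+1)%:R / y `^ b <= ln (l j.+1)%:R / x `^ b.
  move=> x0 xy; have y0 : 0 < y by apply: lt_le_trans xy.
  rewrite ler_wpM2l ?(ltW L0) // lef_pV2 ?posrE ?powR_gt0 //.
  by apply: (ge0_ler_powR (ltW b0)) xy; rewrite nnegrE ltW.
rewrite /scale (negbTE tau0); case: (leqP (l j * gap j) (maxn (2 * l j)
    (Num.truncn (ln (l j.+1)%:R `^ tau^-1)).+1)) => hmin.
  by rewrite lerDl invr_ge0 powR_ge0.
apply: (@le_trans _ _ ((ln (l j.+1)%:R `^ (b / tau - 1))^-1)); last first.
  by rewrite lerDr divr_ge0 ?powR_ge0 // ltW.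
have p0 : 0 < ln (l j.+1)%:R `^ tau^-1 :> R by apply: powR_gt0.
apply: (le_trans (mono _ _ p0 _)).
  by apply: (le_trans (ltW (truncnS_gt _))); rewrite ler_nat leq_maxr.
rewrite -powRrM (mulrC tau^-1) -[X in X / _](powRr1 (ltW L0)) -powRB ?(gt_eqF L0) ?implybT //.
by rewrite -powRN opprB.
Qed.

(** The scale is at most [2 * l j], where [log_len_dominates] applies since [b < 1/2], or at most
    twice the target; the rounding costs the factor [2^b]. *)
Lemma scale_below tau b : tau <= 1 / 2 -> 0 < b -> b < tau ->
  (fun j => ln (l j.+1)%:R / (scale tau j)%:R `^ b : R) @ \oo --> +oo.
Proof.
move=> t2 b0 bt; have tpos : 0 < tau by apply: lt_trans bt.
have b2 : b < 1 / 2 by apply: lt_le_trans t2.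
have h1 := log_len_dominates (R := R) _ b0 b2.
have e0 : 0 < 1 - b / tau by rewrite subr_gt0 ltr_pdivrMr // mul1r.
have c0 : 0 < (2 `^ b)^-1 :> R by rewrite invr_gt0 powR_gt0.
have h2 := cvgy_mulr _ _ c0 (cvgy_powR _ _ e0 (@log_len_cvgy R)).
apply/cvgryPge => A.
move/cvgryPge : h1 => /(_ A) h1; move/cvgryPge : h2 => /(_ A) h2.
have := @log_len_cvgy R => /cvgryPge /(_ 1) h3.
near=> j.
have L1 : 1 <= ln (l j.+1)%:R :> R by near: j.
have L0 : 0 < ln (l j.+1)%:R :> R by apply: lt_le_trans L1.
have mono (x y : R) : 0 < x -> x <= y -> ln (l j.+1)%:R / y `^ b <= ln (l j.+1)%:R / x `^ b.
  move=> x0 xy; have y0 : 0 < y by apply: lt_le_trans xy.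
  rewrite ler_wpM2l ?(ltW L0) // lef_pV2 ?posrE ?powR_gt0 //.
  by apply: (ge0_ler_powR (ltW b0)) xy; rewrite nnegrE ltW.
have sle : (scale tau j <= maxn (2 * l j) (Num.truncn (ln (l j.+1)%:R `^ tau^-1)).+1)%N.
  by rewrite /scale (gt_eqF tpos) geq_minr.
have s0 := scale_gt0 tau j.
case: (leqP (2 * l j) (Num.truncn (ln (l j.+1)%:R `^ tau^-1)).+1) => hmax.
- rewrite (maxn_idPr hmax) in sle.
  have p1 : 1 <= ln (l j.+1)%:R `^ tau^-1 :> R.
    have i0 : 0 <= tau^-1 by rewrite invr_ge0 ltW.
    by have := ler_powR L1 i0; rewrite powRr0.
  have sle2 : (scale tau j)%:R <= 2 * ln (l j.+1)%:R `^ tau^-1 :> R.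
    rewrite -(ler_nat R) in sle; apply: (le_trans sle).
    rewrite -natr1; have : (Num.truncn (ln (l j.+1)%:R `^ tau^-1 : R))%:R <= ln (l j.+1)%:R `^ tau^-1 :> R.
      by rewrite truncn_le (le_trans ler01).
    by move: p1; lra.
  apply: le_trans (mono _ _ s0 sle2).
  have : A <= ln (l j.+1)%:R `^ (1 - b / tau) * (2 `^ b)^-1 by near: j.
  move=> /le_trans; apply; rewrite powRM ?powR_ge0 // -powRrM (mulrC tau^-1).
  rewrite powRB ?(gt_eqF L0) ?implybT // powRr1 ?(ltW L0) // invfM.
  by rewrite mulrA mulrAC.
- rewrite (maxn_idPl (ltnW hmax)) -(ler_nat R) in sle.
  apply: le_trans (mono _ _ s0 sle).
  by near: j.
Unshelve. all: by end_near.
Qed.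

Lemma return_at_scale x (J : nat) (tau b : R) : subshift C x ->
  (forall j, (J <= j)%N -> good_at j x) ->
  \forall j \near \oo,
    ln (l j.+1)%:R / (scale tau j)%:R `^ b = scaled_log_return x b (scale tau j).
Proof.
move=> xX hJ; exists J => // j Jj.
by rewrite /scaled_log_return (R_good j) //; [exact: hJ | exact: scale_bounds].
Qed.

Lemma return_scale_critical x (J : nat) (tau : R) : subshift C x ->
  (forall j, (J <= j)%N -> good_at j x) -> 0 <= tau <= 1 / 2 ->
  critical_value_lim (fun b j => scaled_log_return x b (scale tau j)) tau.
Proof.
move=> xX hJ /andP[t0 t2] b b0; have h := return_at_scale _ _ tau b xX hJ.
split=> hb.
- apply/cvgeryP; apply: cvg_trans (scale_below _ _ t2 b0 hb).
  exact: near_eq_cvg.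
- apply/fine_cvgP; split; first by apply: nearW.
  apply: cvg_trans (scale_above _ _ t0 hb).
  exact: near_eq_cvg.
Qed.

Lemma limn_esup_subseq_y (v : nat -> R) (n_ : nat -> nat) :
  {homo n_ : i j / (i < j)%N} -> (fun j => (v (n_ j))%:E) @ \oo --> +oo%E ->
  limn_esup (fun n => (v n)%:E) = +oo%E.
Proof.
move=> hn /cvgeryP /cvgryPge hv.
have n_ge j : (j <= n_ j)%N.
  by elim: j => // j IH; apply: leq_ltn_trans IH (hn _ _ (ltnSn j)).
rewrite limn_esup_lim (_ : esups _ = cst +oo%E) ?lim_cst //.
apply/funext => n; apply/eqP; rewrite /esups /=; apply/eqP/eq_infty => r.
have [J _ hJ] := hv r.
apply: (@le_trans _ _ (v (n_ (maxn J n)))%:E); first by rewrite lee_fin hJ //= leq_maxl.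
apply: ereal_sup_ubound; exists (n_ (maxn J n)) => //=.
exact: leq_trans (leq_maxr _ _) (n_ge _).
Qed.

Lemma return_limsup_critical x (J n0 : nat) : subshift C x ->
  (forall j, (J <= j)%N -> good_at j x) ->
  (forall n, (n0 <= n)%N -> (0 < R_ x n)%N /\ ln (R_ x n)%:R <= 22 * Num.sqrt n%:R :> R) ->
  critical_value (fun b : R => limn_esup (fun n => (scaled_log_return x b n)%:E)) (1 / 2).
Proof.
move=> xX hJ hR b b0; split=> hb.
- have h12 : 0 <= (1 / 2 : R) <= 1 / 2 by rewrite lexx andbT; lra.
  (* Below 1/2, the times realizing the exponent 1/2 already make the limsup infinite. *)
  apply: (limn_esup_subseq_y _ (scale (1 / 2))); first exact: scale_mono.
  exact: (return_scale_critical _ _ _ xX hJ h12 b b0).1.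
- have bh : 0 < b - 2^-1 by lra.
  have hc : (fun n => 22 / n%:R `^ (b - 2^-1)) @ \oo --> (0 : R).
    by apply: cvg0_const_inv; apply: cvgy_powR bh _; apply: cvgr_idn.
  have hs : (scaled_log_return x b) @ \oo --> (0 : R).
    apply: cvg0_le hc; exists (maxn n0 1) => // n /=; rewrite geq_max => /andP[hn n1].
    have [R0 hRn] := hR n hn; have nr : 0 < n%:R :> R by rewrite ltr0n.
    rewrite /scaled_log_return divr_ge0 ?ln_nat_ge0 ?powR_ge0 //=.
    rewrite ler_pdivrMr ?powR_gt0 //; apply: (le_trans hRn).
    rewrite powRB ?(gt_eqF nr) ?implybT // powR12_sqrt ?ler0n // invf_div.
    by rewrite -!mulrA mulVf ?mulr1 // gt_eqF // powR_gt0.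
  have he : (fun n => (scaled_log_return x b n)%:E) @ \oo --> 0%E.
    by apply/fine_cvgP; split; [apply: nearW | exact: hs].
  rewrite is_cvg_limn_esupE; last by apply/cvg_ex; exists 0%E.
  exact/cvg_lim.
Qed.

Lemma marker_return_times (mu : probability Omega R) :
  mu (subshift C) = 1%E ->
  (forall A : set Omega, measurable A -> mu ((sshift : Omega -> Omega) @^-1` A) = mu A) ->
  (exists A : set Omega, [/\ measurable A, mu A = 1%E &
     forall x, A x -> subshift C x ->
       critical_value
         (fun b : R => limn_esup (fun n => (scaled_log_return x b n)%:E))
         (1 / 2)]) /\
  (exists Xhat : set Omega,
     [/\ measurable Xhat, Xhat `<=` subshift C, mu Xhat = 1%E &
     forall tau : R, 0 <= tau <= 1 / 2 ->
       exists nj : nat -> nat, {homo nj : a b / (a < b)%N} /\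
         forall x, Xhat x ->
           critical_value_lim
             (fun (b : R) (j : nat) => scaled_log_return x b (nj j)) tau]).
Proof.
move=> muX mu_inv.
have [G [mG GX G1] hG] := ae_good _ _ muX mu_inv.
have exW n : exists W : seq (seq bool), (forall x, subshift C x -> window x 0 n \in W) /\
    ((l 0 <= n)%N -> ln ((size W).+1 * (n.+1 * n.+2))%:R <= 22 * Num.sqrt n%:R :> R).
  case: (leqP (l 0) n) => hn; first by have [W [hW bW]] := window_count (R := R) _ hn; exists W.
  (* For the finitely many [n] below [l 0] any list of windows will do. *)
  have nl : (n <= l 1)%N by apply: (leq_trans (ltnW hn)); apply: len_le.
  have [|W _ hW] := window_list 0 n (n %/ l 0 + 2) nl; first by nia.
  by exists W; split.
have [W hW] := choice exW.
have [A [mA AX A1] hA] := ae_return _ _ muX mu_inv W (fun n => (hW n).1).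
split; last first.
  exists G; split=> // tau ht; exists (scale tau); split; first exact: scale_mono.
  by move=> x Gx; have [J hJ] := hG x Gx; apply: return_scale_critical hJ ht; apply: GX.
exists (A `&` G); split.
- exact: measurableI.
- by rewrite measure_inter_full.
- move=> x [Ax Gx] xX; have [J hJ] := hG x Gx; have [n0 hn0] := hA x Ax.
  apply: (return_limsup_critical _ J (maxn n0 (l 0)) xX hJ) => n.
  rewrite geq_max => /andP[h1 h2]; have /andP[R0 RW] := hn0 n h1; split=> //.
  by apply: le_trans ((hW n).2 h2); apply: ln_nat_le; rewrite R0.
Qed.

End ReturnTimes.
End Construction.

Local Close Scope nat_scope.
Local Open Scope ring_scope.
Local Open Scope classical_set_scope.

Theorem theorem4p7 (R : realType) :
  exists L : nat, forall (l1 s : nat), l1 = (s * s)%N -> (L <= l1)%N ->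
  forall C : nat -> seq (seq bool), marker_construction l1 C ->
  forall mu : probability Omega R,
    mu (subshift C) = 1%E ->
    (forall A : set Omega, measurable A -> mu ((sshift : Omega -> Omega) @^-1` A) = mu A) ->
    (* (1) *)
    (exists A : set Omega, [/\ measurable A, mu A = 1%E &
       forall x, A x -> subshift C x ->
         critical_value
           (fun b : R => limn_esup (fun n => (scaled_log_return x b n)%:E))
           (1 / 2)]) /\
    (* (2) *)
    (exists Xhat : set Omega,
       [/\ measurable Xhat, Xhat `<=` subshift C, mu Xhat = 1%E &
       forall tau : R, 0 <= tau <= 1 / 2 ->
         exists nj : nat -> nat, {homo nj : a b / (a < b)%N} /\
           forall x, Xhat x ->
             critical_value_lim
               (fun (b : R) (j : nat) => scaled_log_return x b (nj j)) tau]).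
Proof.
(* 400 is the square of 20, the lower bound on [s] assumed throughout the construction. *)
exists 400%N => l1 s l1E hl C hC mu muX mu_inv.
have s20 : (20 <= s)%N by nia.
exact: (marker_return_times l1 s C l1E s20 hC mu muX mu_inv).
Qed.
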